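(* Fix $j>0$. There exist constants $c<\infty$ and $b>0$, independent of $N$, such that for every integer $N\ge 2$, every probability measure $\mu_N$ on $\{0,1\}^{[-N,N]}$ and every $t>0$, $$\|\mu_N S_t-\mu^{\rm st}_N\|\le c\,N\,e^{-bN^{-2}t}.$$
   Context: For a positive integer $N$, consider the continuous-time Markov process on $\{0,1\}^{[-N,N]}$ with generator $L=L_0+L_{b,+}+L_{b,-}$, where for $f:\{0,1\}^{[-N,N]}\to\mathbb R$, $$L_0 f(\eta)=\frac12\sum_{x=-N}^{N-1}[f(\eta^{(x,x+1)})-f(\eta)],$$ $\eta^{(x,x+1)}$ being $\eta$ with the values at $x$ and $x+1$ exchanged, and $$L_{b,\pm}f(\eta)=\frac{j}{2N}\sum_{x\in I_\pm}D_\pm\eta(x)\,[f(\eta^{(x)})-f(\eta)],$$ with $I_+=\{N-1,N\}$, $I_-=\{-N,-N+1\}$, $\eta^{(x)}$ the configuration $\eta$ with the value at $x$ flipped ($\eta(x)\mapsto 1-\eta(x)$), and $$D_+\eta(x)=(1-\eta(x))\,\eta(x+1)\cdots\eta(N),\qquad D_-\eta(x)=\eta(x)\,(1-\eta(x-1))\cdots(1-\eta(-N))$$ (empty products equal $1$). Thus at rate $j/(2N)$ a particle is added at the last empty site of $I_+$ (if any) and at rate $j/(2N)$ the first particle in $I_-$ (if any) is removed. This process has a unique stationary probability measure $\mu^{\rm st}_N$. For a probability measure $\mu_N$, $\mu_NS_t$ denotes the law at time $t$ of the process started with law $\mu_N$. For a signed measure $\lambda$ on $\{0,1\}^{[-N,N]}$,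 $\|\lambda\|=\sum_\eta|\lambda(\eta)|$. *)

(* Defs.v *)
From Stdlib Require Import Reals Lra List Factorial.
Import ListNotations.
Open Scope R_scope.

(* Configurations on [-N,N] are bool lists of length 2N+1:
   list index i (0 <= i <= 2N) corresponds to the site x = i - N. *)

Fixpoint configs (n : nat) : list (list bool) :=
  match n with
  | O => [nil]
  | S m => map (cons false) (configs m) ++ map (cons true) (configs m)
  end.

Definition Conf (N : nat) : list (list bool) := configs (2 * N + 1).

Definition sumL {A : Type} (l : list A) (f : A -> R) : R :=
  fold_right (fun a s => f a + s) 0 l.

Definition occ (eta : list bool) (i : nat) : R :=
  if nth i eta false then 1 else 0.

Fixpoint upd (l : list bool) (i : nat) (b : bool) : list bool :=
  match l, i with
  | nil, _ => nil
  | _ :: l', O => b :: l'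
  | x :: l', S i' => x :: upd l' i' b
  end.

Definition swap (eta : list bool) (i k : nat) : list bool :=
  upd (upd eta i (nth k eta false)) k (nth i eta false).

Definition flip (eta : list bool) (i : nat) : list bool :=
  upd eta i (negb (nth i eta false)).

Definition prodR (a n : nat) (f : nat -> R) : R :=
  fold_right Rmult 1 (map f (seq a n)).

Definition Dplus (N : nat) (eta : list bool) (i : nat) : R :=
  (1 - occ eta i) * prodR (i + 1) (2 * N - i) (occ eta).

Definition Dminus (eta : list bool) (i : nat) : R :=
  occ eta i * prodR 0 i (fun k => 1 - occ eta k).

Definition L0 (N : nat) (f : list bool -> R) (eta : list bool) : R :=
  / 2 * sumL (seq 0 (2 * N)) (fun i => f (swap eta i (i + 1)) - f eta).

(* I_+ = {N-1, N}  <->  indices {2N-1, 2N} *)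
Definition Lbplus (N : nat) (j : R) (f : list bool -> R) (eta : list bool) : R :=
  j / (2 * INR N) *
  sumL [(2 * N - 1)%nat; (2 * N)%nat]
       (fun i => Dplus N eta i * (f (flip eta i) - f eta)).

(* I_- = {-N, -N+1}  <->  indices {0, 1} *)
Definition Lbminus (N : nat) (j : R) (f : list bool -> R) (eta : list bool) : R :=
  j / (2 * INR N) *
  sumL [0%nat; 1%nat]
       (fun i => Dminus eta i * (f (flip eta i) - f eta)).

Definition Lgen (N : nat) (j : R) (f : list bool -> R) (eta : list bool) : R :=
  L0 N f eta + Lbplus N j f eta + Lbminus N j f eta.

Definition Lpow (N : nat) (j : R) (k : nat) (f : list bool -> R) : list bool -> R :=
  Nat.iter k (Lgen N j) f.

Definition indicator (zeta : list bool) : list bool -> R :=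
  fun eta => if list_eq_dec Bool.bool_dec eta zeta then 1 else 0.

Definition pairing (N : nat) (mu : list bool -> R) (f : list bool -> R) : R :=
  sumL (Conf N) (fun eta => mu eta * f eta).

Definition is_prob (N : nat) (mu : list bool -> R) : Prop :=
  (forall eta, In eta (Conf N) -> 0 <= mu eta) /\ sumL (Conf N) mu = 1.

(* nu = mu S_t, with S_t = e^{tL} = sum_k t^k L^k / k! :
   nu(zeta) = mu(S_t 1_zeta) *)
Definition law_at (N : nat) (j : R) (mu : list bool -> R) (t : R)
  (nu : list bool -> R) : Prop :=
  forall zeta, In zeta (Conf N) ->
    Un_cv (fun n => sum_f_R0
             (fun k => t ^ k / INR (fact k) *
                       pairing N mu (Lpow N j k (indicator zeta))) n)
          (nu zeta).

Definition stationary (N : nat) (j : R) (pi : list bool -> R) : Prop :=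
  forall f : list bool -> R, pairing N pi (Lgen N j f) = 0.

Definition tvnorm (N : nat) (lam : list bool -> R) : R :=
  sumL (Conf N) (fun eta => Rabs (lam eta)).

(* Main.v *)
(** Write the generator as [L f = Lam (Q f - f)], where [Q] averages [f] over deterministic
    events (exchange, injection, removal).  Running the same events from two configurations
    differing at one site keeps at most one discrepancy, which does a stirring walk and dies
    at the right end when its neighbour there is occupied, at the left end when its neighbour
    there is empty.  By path coupling it suffices to find a function
    [V] of the discrepancy and its environment, with values in [1/2, 2], whose drift is at
    most [- b V / N^2].  We take [V] to be 1 minus a small multiple of
    [sum_y u(x,y)], where for an occupied [y] the pair potential [u] is measured from the right
    end and for an empty [y] from the left end.  The potential is a perturbation of the
    two-dimensional Green function [- log |.|^2] with pole at the corner (the two sites of the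
    reservoir): for two stirred particles it is subharmonic, with Laplacian at least of order
    [N^-2], except at the corner, where the loss is paid by the death rate.  Since every
    [y] contributes, occupied or not, the total drift is of order [- N^-2].  A parabola in
    [x] pays for the boundary events once [N] is large; the finitely many remaining [N] are
    handled by Doeblin's argument, the full configuration being reachable from any other. *)

From Stdlib Require Import Reals List Lra Lia Psatz Permutation Bool Factorial.
From Coquelicot Require Import Coquelicot.
(* Imported last: [Reals] has its own [Dminus]. *)
Require Import Defs.
Import ListNotations.
Open Scope R_scope.
Set Bullet Behavior "Strict Subproofs".

(** * Finite sums and configurations *)

(** The orders in N fit together as follows. There are 2N partners [y], each with a drift of order
    N^-2, so the sum of the potentials drifts by order 1/N. That sum itself is of order N, without a
    logarithm, so its coefficient [delta] may be of order 1/N, and the drift of [V] becomes N^-2.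
    With this [delta] the loss at a corner pair is of order 1/N, like the death rate j/(2N), and a
    small constant in [delta] lets the death win. The environment must enter [V] because a
    discrepancy at a reservoir site survives a boundary event when the other site is in the wrong
    state; the loss occurs only for the pairs where it dies. A surviving discrepancy sees a boundary
    event lower the potential sum only from an end site, by O(1); after multiplication by [delta]
    and the rate this is of order N^-2, while the slope of the parabola there yields order 1/N. Laws
    are compared through oscillations of test functions, and the factor N counts the sites where two
    configurations can differ. *)

Lemma sumL_ext {A} (l : list A) (f g : A -> R) :
  (forall a, In a l -> f a = g a) -> sumL l f = sumL l g.
Proof.
  induction l as [|a l IH]; intros H; simpl; [easy|].
  rewrite H by now left. rewrite IH; [easy|]. intros b Hb. apply H. now right.
Qed.

Lemma sumL_le {A} (l : list A) (f g : A -> R) :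
  (forall a, In a l -> f a <= g a) -> sumL l f <= sumL l g.
Proof.
  induction l as [|a l IH]; intros H; simpl; [lra|].
  apply Rplus_le_compat; [apply H; now left|].
  apply IH. intros b Hb. apply H. now right.
Qed.

Lemma sumL_plus {A} (l : list A) (f g : A -> R) :
  sumL l (fun a => f a + g a) = sumL l f + sumL l g.
Proof. induction l as [|a l IH]; simpl; [lra|]. rewrite IH. lra. Qed.

Lemma sumL_minus {A} (l : list A) (f g : A -> R) :
  sumL l (fun a => f a - g a) = sumL l f - sumL l g.
Proof. induction l as [|a l IH]; simpl; [lra|]. rewrite IH. lra. Qed.

Lemma sumL_scal {A} (l : list A) (c : R) (f : A -> R) :
  sumL l (fun a => c * f a) = c * sumL l f.
Proof. induction l as [|a l IH]; simpl; [lra|]. rewrite IH. lra. Qed.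

Lemma sumL_const {A} (l : list A) (c : R) : sumL l (fun _ => c) = INR (length l) * c.
Proof.
  induction l as [|a l IH]; [simpl; lra|].
  change (length (a :: l)) with (S (length l)). rewrite S_INR. simpl. rewrite IH. lra.
Qed.

Lemma sumL_abs {A} (l : list A) (f : A -> R) :
  Rabs (sumL l f) <= sumL l (fun a => Rabs (f a)).
Proof.
  induction l as [|a l IH]; simpl; [rewrite Rabs_R0; lra|].
  eapply Rle_trans; [apply Rabs_triang|]. lra.
Qed.

Lemma sumL_exchange {A B} (l : list A) (m : list B) (f : A -> B -> R) :
  sumL l (fun a => sumL m (f a)) = sumL m (fun b => sumL l (fun a => f a b)).
Proof.
  induction l as [|a l IH]; simpl.
  - rewrite sumL_const. lra.
  - rewrite IH, sumL_plus. reflexivity.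
Qed.

Lemma sumL_app {A} (l m : list A) (f : A -> R) : sumL (l ++ m) f = sumL l f + sumL m f.
Proof. induction l as [|a l IH]; simpl; [lra|]. rewrite IH. lra. Qed.

Lemma sumL_seq_S (n : nat) (f : nat -> R) :
  sumL (seq 0 (S n)) f = sumL (seq 0 n) f + f n.
Proof. rewrite seq_S, sumL_app. simpl. lra. Qed.

Lemma sumL_map {A B} (h : A -> B) (l : list A) (f : B -> R) :
  sumL (map h l) f = sumL l (fun a => f (h a)).
Proof. induction l as [|a l IH]; simpl; [easy|]. now rewrite IH. Qed.

Lemma sumL_perm {A} (l m : list A) (f : A -> R) :
  Permutation l m -> sumL l f = sumL m f.
Proof. induction 1; simpl; lra. Qed.

Lemma sumL_involution (n : nat) (s : nat -> nat) (f : nat -> R) :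
  (forall y, (y < n)%nat -> (s y < n)%nat) -> (forall y, (y < n)%nat -> s (s y) = y) ->
  sumL (seq 0 n) (fun y => f (s y)) = sumL (seq 0 n) f.
Proof.
  intros Hs Hss. rewrite <- (sumL_map s). apply sumL_perm.
  apply NoDup_Permutation.
  - apply NoDup_map_NoDup_ForallPairs; [|apply seq_NoDup].
    intros a b Ha Hb E. apply in_seq in Ha, Hb.
    rewrite <- (Hss a), <- (Hss b) by lia. now rewrite E.
  - apply seq_NoDup.
  - intros y. rewrite in_map_iff, in_seq. split.
    + intros (z & <- & Hz). apply in_seq in Hz. specialize (Hs z). lia.
    + intros Hy. exists (s y). split; [apply Hss; lia|]. apply in_seq.
      specialize (Hs y). lia.
Qed.

Lemma sumL_single (n c : nat) (v : R) :
  sumL (seq 0 n) (fun i => if (i =? c)%nat then v else 0) = if (c <? n)%nat then v else 0.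
Proof.
  induction n as [|n IH]; [now destruct c|].
  rewrite sumL_seq_S, IH.
  destruct (Nat.ltb_spec c n), (Nat.ltb_spec c (S n)), (Nat.eqb_spec n c); try lia; lra.
Qed.

Lemma in_configs (n : nat) (eta : list bool) : In eta (configs n) <-> length eta = n.
Proof.
  revert eta. induction n as [|n IH]; intros eta; simpl.
  - destruct eta; simpl; split; intros H; try easy; [now left|destruct H; easy].
  - rewrite in_app_iff, !in_map_iff. split.
    + intros [(z & <- & Hz)|(z & <- & Hz)]; simpl; f_equal; now apply IH.
    + destruct eta as [|b eta]; simpl; [easy|]. intros [=].
      destruct b; [right|left]; exists eta; split; auto; now apply IH.
Qed.

Lemma NoDup_configs (n : nat) : NoDup (configs n).
Proof.
  induction n as [|n IH]; simpl; [repeat constructor; easy|].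
  assert (I : forall b, NoDup (map (cons b) (configs n))).
  { intros b. apply NoDup_map_NoDup_ForallPairs; [|easy]. intros x y _ _ E. now injection E. }
  apply NoDup_app; auto.
  intros a H1 H2. apply in_map_iff in H1 as (x & <- & _). apply in_map_iff in H2 as (y & E & _).
  easy.
Qed.

Lemma upd_length (l : list bool) (i : nat) (b : bool) : length (upd l i b) = length l.
Proof. revert i. induction l as [|x l IH]; intros [|i]; simpl; auto. Qed.

Lemma nth_upd (l : list bool) (i k : nat) (b : bool) : (i < length l)%nat ->
  nth k (upd l i b) false = if (k =? i)%nat then b else nth k l false.
Proof.
  revert i k. induction l as [|x l IH]; intros [|i] [|k] H; simpl in *; try lia; auto.
  apply IH. lia.
Qed.

Lemma upd_app (p l : list bool) (x b : bool) :
  upd (p ++ x :: l) (length p) b = p ++ b :: l.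
Proof. induction p as [|y p IH]; simpl; [easy|]. now rewrite IH. Qed.

Lemma flip_length (l : list bool) (i : nat) : length (flip l i) = length l.
Proof. apply upd_length. Qed.

Lemma nth_flip (l : list bool) (i k : nat) : (i < length l)%nat ->
  nth k (flip l i) false = if (k =? i)%nat then negb (nth i l false) else nth k l false.
Proof. apply nth_upd. Qed.

Lemma swap_length (l : list bool) (i k : nat) : length (swap l i k) = length l.
Proof. unfold swap. now rewrite !upd_length. Qed.

Lemma bool_list_ext (l m : list bool) : length l = length m ->
  (forall i, (i < length l)%nat -> nth i l false = nth i m false) -> l = m.
Proof.
  intros E H. apply (nth_ext l m false false E H).
Qed.

(** * Boundary events as maps of configurations *)

Definition inject (N : nat) (eta : list bool) : list bool :=
  if nth (2 * N) eta false
  then if nth (2 * N - 1) eta false then eta else flip eta (2 * N - 1)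
  else flip eta (2 * N).

Definition remove_first (eta : list bool) : list bool :=
  if nth 0 eta false then flip eta 0
  else if nth 1 eta false then flip eta 1 else eta.

Lemma inject_length (N : nat) (eta : list bool) : length (inject N eta) = length eta.
Proof. unfold inject. repeat destruct (nth _ _ _); auto using flip_length. Qed.

Lemma remove_first_length (eta : list bool) : length (remove_first eta) = length eta.
Proof. unfold remove_first. repeat destruct (nth _ _ _); auto using flip_length. Qed.

Definition brate (N : nat) (j : R) : R := j / (2 * INR N).

(** The rate is the same in all configurations because boundary events keep their clock when they
    change nothing: [inject] fixes a full pair of sites, [remove_first] an empty one. *)
Definition total_rate (N : nat) (j : R) : R := INR N + 2 * brate N j.

Definition jump (N : nat) (j : R) (f : list bool -> R) (eta : list bool) : R :=
  / total_rate N j *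
  (/ 2 * sumL (seq 0 (2 * N)) (fun i => f (swap eta i (i + 1)))
   + brate N j * f (inject N eta) + brate N j * f (remove_first eta)).

Lemma brate_pos (N : nat) (j : R) : (1 <= N)%nat -> 0 < j -> 0 < brate N j.
Proof.
  intros HN Hj. apply le_INR in HN. simpl in HN. unfold brate.
  apply Rdiv_lt_0_compat; lra.
Qed.

Lemma total_rate_pos (N : nat) (j : R) : (1 <= N)%nat -> 0 < j -> 0 < total_rate N j.
Proof.
  intros HN Hj. pose proof (brate_pos N j HN Hj). apply le_INR in HN. simpl in HN.
  unfold total_rate. lra.
Qed.

Lemma Lgen_jump (N : nat) (j : R) (f : list bool -> R) (eta : list bool) :
  (1 <= N)%nat -> 0 < j ->
  Lgen N j f eta = total_rate N j * (jump N j f eta - f eta).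
Proof.
  intros HN Hj. pose proof (total_rate_pos N j HN Hj) as HL.
  unfold Lgen, L0, Lbplus, Lbminus, jump. fold (brate N j).
  rewrite sumL_minus, sumL_const, length_seq, mult_INR.
  replace (INR 2) with 2 by (simpl; lra).
  assert (Hp : sumL [(2 * N - 1)%nat; (2 * N)%nat]
                 (fun i => Dplus N eta i * (f (flip eta i) - f eta))
               = f (inject N eta) - f eta).
  { cbn [sumL fold_right]. unfold Dplus, prodR, inject, occ.
    replace (2 * N - (2 * N - 1))%nat with 1%nat by lia.
    replace (2 * N - 1 + 1)%nat with (2 * N)%nat by lia.
    rewrite Nat.sub_diag. cbn [seq map fold_right].
    destruct (nth (2 * N) eta false), (nth (2 * N - 1) eta false); lra. }
  assert (Hm : sumL [0%nat; 1%nat]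
                 (fun i => Dminus eta i * (f (flip eta i) - f eta))
               = f (remove_first eta) - f eta).
  { cbn [sumL fold_right]. unfold Dminus, prodR, remove_first, occ. cbn [seq map fold_right].
    destruct (nth 0 eta false), (nth 1 eta false); lra. }
  rewrite Hp, Hm. unfold total_rate in *. field. lra.
Qed.

(** * The jump chain *)

Definition jpow (N : nat) (j : R) (k : nat) (f : list bool -> R) : list bool -> R :=
  Nat.iter k (jump N j) f.

Lemma jump_ext (N : nat) (j : R) (f g : list bool -> R) (eta : list bool) :
  (forall xi, f xi = g xi) -> jump N j f eta = jump N j g eta.
Proof.
  intros H. unfold jump. rewrite !H. erewrite sumL_ext; [reflexivity|]. intros i _. apply H.
Qed.

Lemma jump_plus (N : nat) (j : R) (f g : list bool -> R) (eta : list bool) :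
  jump N j (fun xi => f xi + g xi) eta = jump N j f eta + jump N j g eta.
Proof. unfold jump. rewrite sumL_plus. lra. Qed.

Lemma jump_scal (N : nat) (j c : R) (f : list bool -> R) (eta : list bool) :
  jump N j (fun xi => c * f xi) eta = c * jump N j f eta.
Proof. unfold jump. rewrite sumL_scal. lra. Qed.

Lemma jump_const (N : nat) (j c : R) (eta : list bool) : (1 <= N)%nat -> 0 < j ->
  jump N j (fun _ => c) eta = c.
Proof.
  intros HN Hj. unfold jump. rewrite sumL_const, length_seq, mult_INR.
  replace (INR 2) with 2 by (simpl; lra).
  pose proof (total_rate_pos N j HN Hj). unfold total_rate in *. field. lra.
Qed.

Lemma jump_le (N : nat) (j : R) (f g : list bool -> R) (eta : list bool) :
  (1 <= N)%nat -> 0 < j -> length eta = (2 * N + 1)%nat ->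
  (forall xi, length xi = (2 * N + 1)%nat -> f xi <= g xi) ->
  jump N j f eta <= jump N j g eta.
Proof.
  intros HN Hj He H. unfold jump.
  pose proof (total_rate_pos N j HN Hj). pose proof (brate_pos N j HN Hj).
  apply Rmult_le_compat_l; [left; now apply Rinv_0_lt_compat|].
  assert (sumL (seq 0 (2 * N)) (fun i => f (swap eta i (i + 1)))
          <= sumL (seq 0 (2 * N)) (fun i => g (swap eta i (i + 1)))).
  { apply sumL_le. intros i _. apply H. now rewrite swap_length. }
  assert (f (inject N eta) <= g (inject N eta)) by (apply H; now rewrite inject_length).
  assert (f (remove_first eta) <= g (remove_first eta))
    by (apply H; now rewrite remove_first_length).
  nra.
Qed.

Lemma jpow_bound (N : nat) (j m M : R) (f : list bool -> R) (k : nat) (eta : list bool) :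
  (1 <= N)%nat -> 0 < j -> length eta = (2 * N + 1)%nat ->
  (forall xi, length xi = (2 * N + 1)%nat -> m <= f xi <= M) ->
  m <= jpow N j k f eta <= M.
Proof.
  intros HN Hj He H. revert eta He. induction k as [|k IH]; intros eta He; [now apply H|].
  change (jpow N j (S k) f eta) with (jump N j (jpow N j k f) eta). split.
  - rewrite <- (jump_const N j m eta HN Hj). apply jump_le; auto. intros. now apply IH.
  - rewrite <- (jump_const N j M eta HN Hj). apply jump_le; auto. intros. now apply IH.
Qed.

(** Oscillation form of a total-variation estimate: being uniform in both starting points, it
    survives averaging over any two initial laws. *)
Definition contracts (N : nat) (j K th : R) : Prop :=
  forall f : list bool -> R,
    (forall eta, length eta = (2 * N + 1)%nat -> Rabs (f eta) <= 1) ->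
    forall k eta xi, length eta = (2 * N + 1)%nat -> length xi = (2 * N + 1)%nat ->
      Rabs (jpow N j k f eta - jpow N j k f xi) <= K * th ^ k.

(** * Averages against probability measures *)

Lemma in_Conf (N : nat) (eta : list bool) : In eta (Conf N) <-> length eta = (2 * N + 1)%nat.
Proof. apply in_configs. Qed.

Lemma pairing_le (N : nat) (mu f g : list bool -> R) : is_prob N mu ->
  (forall eta, length eta = (2 * N + 1)%nat -> f eta <= g eta) ->
  pairing N mu f <= pairing N mu g.
Proof.
  intros [Hp _] H. apply sumL_le. intros eta He.
  apply Rmult_le_compat_l; [now apply Hp|]. apply H. now apply in_Conf.
Qed.

Lemma pairing_const (N : nat) (mu : list bool -> R) (c : R) : is_prob N mu ->
  pairing N mu (fun _ => c) = c.
Proof.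
  intros [_ H1]. unfold pairing.
  rewrite (sumL_ext _ _ (fun eta => c * mu eta)) by (intros; ring).
  rewrite sumL_scal, H1. ring.
Qed.

Lemma pairing_ext (N : nat) (mu f g : list bool -> R) :
  (forall eta, length eta = (2 * N + 1)%nat -> f eta = g eta) ->
  pairing N mu f = pairing N mu g.
Proof.
  intros H. apply sumL_ext. intros eta He. f_equal. apply H. now apply in_Conf.
Qed.

Lemma pairing_lin (N : nat) (mu f g : list bool -> R) (a b : R) :
  pairing N mu (fun eta => a * f eta + b * g eta) = a * pairing N mu f + b * pairing N mu g.
Proof.
  unfold pairing. rewrite <- !sumL_scal, <- sumL_plus. apply sumL_ext. intros; ring.
Qed.

Lemma pairing_close (N : nat) (mu f : list bool -> R) (c K : R) : is_prob N mu ->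
  (forall eta, length eta = (2 * N + 1)%nat -> Rabs (f eta - c) <= K) ->
  Rabs (pairing N mu f - c) <= K.
Proof.
  intros Hmu H.
  assert (E : pairing N mu f - c = pairing N mu (fun eta => f eta - c)).
  { rewrite (pairing_ext N mu (fun eta => f eta - c) (fun eta => 1 * f eta + (-c) * 1))
      by (intros; ring).
    rewrite (pairing_lin N mu f (fun _ => 1)), pairing_const by easy. ring. }
  rewrite E. apply Rabs_le.
  pose proof (pairing_const N mu (-K) Hmu) as E1. pose proof (pairing_const N mu K Hmu) as E2.
  split; [rewrite <- E1 at 1|rewrite <- E2 at 1]; apply pairing_le; auto; intros eta He;
    specialize (H eta He); apply Rabs_le_between in H; lra.
Qed.

(** Stationarity kills the average of [total_rate N j * (jump N j g - g)]; the rate is nonzero, so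
    one step preserves the average, hence so do all. *)
Lemma stationary_jpow (N : nat) (j : R) (pist f : list bool -> R) (k : nat) :
  (1 <= N)%nat -> 0 < j -> stationary N j pist ->
  pairing N pist (jpow N j k f) = pairing N pist f.
Proof.
  intros HN Hj Hst. induction k as [|k IH]; [easy|].
  change (jpow N j (S k) f) with (jump N j (jpow N j k f)).
  rewrite <- IH. set (g := jpow N j k f).
  specialize (Hst g). pose proof (total_rate_pos N j HN Hj) as HL.
  rewrite (pairing_ext N pist _
    (fun eta => total_rate N j * jump N j g eta + (- total_rate N j) * g eta)) in Hst
    by (intros; rewrite Lgen_jump by easy; ring).
  rewrite pairing_lin in Hst. nra.
Qed.

Lemma contracts_stationary (N : nat) (j K th : R) (mu pist f : list bool -> R) (k : nat) :
  (1 <= N)%nat -> 0 < j -> contracts N j K th ->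
  is_prob N mu -> is_prob N pist -> stationary N j pist ->
  (forall eta, length eta = (2 * N + 1)%nat -> Rabs (f eta) <= 1) ->
  Rabs (pairing N mu (jpow N j k f) - pairing N pist f) <= K * th ^ k.
Proof.
  intros HN Hj HC Hmu Hpi Hst Hf. apply pairing_close; [easy|]. intros eta He.
  rewrite <- (stationary_jpow N j pist f k HN Hj Hst), Rabs_minus_sym.
  apply pairing_close; [easy|]. intros xi Hxi. now apply HC.
Qed.

(* The binomial theorem for the operator [lam + shift]. *)
Lemma binomial_shift (lam : R) (b : nat -> nat -> R) (k m : nat) :
  (forall k m, b (S k) m = lam * b k m + b k (S m)) ->
  b k m = sum_f_R0 (fun i => Binomial.C k i * lam ^ (k - i) * b 0%nat (m + i)%nat) k.
Proof.
  intros H. revert m. induction k as [|k IH]; intros m.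
  - simpl. unfold Binomial.C. simpl. rewrite Nat.add_0_r. field.
  - rewrite H, (IH m), (IH (S m)).
    destruct k as [|k].
    + simpl. unfold Binomial.C. simpl. rewrite Nat.add_0_r, Nat.add_1_r. field.
    (* The first and last terms are split off; Pascal's rule divides each remaining coefficient
       between the factor [lam] and the shift. *)
    + rewrite (decomp_sum _ (S (S k))) by lia. cbn [pred].
      rewrite (tech5 (fun i => Binomial.C (S (S k)) (S i) * lam ^ (S (S k) - S i)
                               * b 0%nat (m + S i)%nat) k).
      rewrite (sum_eq (fun i => Binomial.C (S (S k)) (S i) * lam ^ (S (S k) - S i)
                                * b 0%nat (m + S i)%nat)
        (fun i => Binomial.C (S k) (S i) * lam ^ (S (S k) - S i) * b 0%nat (m + S i)%nat
          + Binomial.C (S k) i * lam ^ (S k - i) * b 0%nat (S m + i)%nat)).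
      2:{ intros i Hi. rewrite <- pascal by lia. cbn [Nat.sub].
          replace (m + S i)%nat with (S m + i)%nat by lia. ring. }
      rewrite sum_plus.
      rewrite (decomp_sum (fun i => Binomial.C (S k) i * lam ^ (S k - i)
                                    * b 0%nat (m + i)%nat) (S k)) by lia.
      cbn [pred].
      rewrite Rmult_plus_distr_l, scal_sum.
      rewrite (tech5 (fun i => Binomial.C (S k) i * lam ^ (S k - i) * b 0%nat (S m + i)%nat) k).
      rewrite (sum_eq (fun i => Binomial.C (S k) (S i) * lam ^ (S k - S i)
                                * b 0%nat (m + S i)%nat * lam)
        (fun i => Binomial.C (S k) (S i) * lam ^ (S (S k) - S i) * b 0%nat (m + S i)%nat)).
      2:{ intros i Hi. replace (S (S k) - S i)%nat with (S (S k - S i)) by lia.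
          cbn [pow]. ring. }
      assert (C0 : forall n, Binomial.C n 0 = 1).
      { intros n. unfold Binomial.C. simpl. rewrite Nat.sub_0_r. field. apply INR_fact_neq_0. }
      assert (Cn : forall n, Binomial.C n n = 1).
      { intros n. unfold Binomial.C. rewrite Nat.sub_diag. simpl. field. apply INR_fact_neq_0. }
      rewrite !C0, !Cn, !Nat.sub_diag, !Nat.sub_0_r. cbn [pow].
      replace (m + S (S k))%nat with (S m + S k)%nat by lia. ring.
Qed.

(** * From the jump chain to continuous time *)

Lemma jump_eq_on_conf (N : nat) (j : R) (f g : list bool -> R) (eta : list bool) :
  (1 <= N)%nat -> 0 < j -> length eta = (2 * N + 1)%nat ->
  (forall xi, length xi = (2 * N + 1)%nat -> f xi = g xi) ->
  jump N j f eta = jump N j g eta.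
Proof.
  intros HN Hj He H. apply Rle_antisym; apply jump_le; auto; intros xi Hxi;
    rewrite (H xi Hxi); lra.
Qed.

Lemma Lpow_eq_on_conf (N : nat) (j : R) (f g : list bool -> R) (k : nat) (eta : list bool) :
  (1 <= N)%nat -> 0 < j -> length eta = (2 * N + 1)%nat ->
  (forall xi, length xi = (2 * N + 1)%nat -> f xi = g xi) ->
  Lpow N j k f eta = Lpow N j k g eta.
Proof.
  intros HN Hj He H. revert eta He. induction k as [|k IH]; intros eta He; [now apply H|].
  change (Lgen N j (Lpow N j k f) eta = Lgen N j (Lpow N j k g) eta).
  rewrite !Lgen_jump, (IH eta He) by easy. f_equal. f_equal.
  now apply jump_eq_on_conf.
Qed.

Lemma jpow_lin (N : nat) (j a b : R) (f g h : list bool -> R) (k : nat) (eta : list bool) :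
  (1 <= N)%nat -> 0 < j ->
  (forall xi, h xi = a * f xi + b * g xi) ->
  jpow N j k h eta = a * jpow N j k f eta + b * jpow N j k g eta.
Proof.
  intros HN Hj H. revert eta. induction k as [|k IH]; intros eta; [apply H|].
  change (jump N j (jpow N j k h) eta
    = a * jump N j (jpow N j k f) eta + b * jump N j (jpow N j k g) eta).
  rewrite (jump_ext N j _ _ eta IH), jump_plus, !jump_scal. reflexivity.
Qed.

Lemma jpow_succ_r (N : nat) (j : R) (f : list bool -> R) (k : nat) :
  jpow N j (S k) f = jpow N j k (jump N j f).
Proof. apply Nat.iter_succ_r. Qed.

Lemma Lpow_sumL (N : nat) (j : R) {A} (l : list A) (c : A -> R) (f : A -> list bool -> R)
  (k : nat) (eta : list bool) : (1 <= N)%nat -> 0 < j ->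
  Lpow N j k (fun xi => sumL l (fun a => c a * f a xi)) eta
  = sumL l (fun a => c a * Lpow N j k (f a) eta).
Proof.
  intros HN Hj. revert eta. induction k as [|k IH]; intros eta; [easy|].
  change (Lgen N j (Lpow N j k (fun xi => sumL l (fun a => c a * f a xi))) eta
    = sumL l (fun a => c a * Lgen N j (Lpow N j k (f a)) eta)).
  rewrite Lgen_jump by easy. rewrite IH.
  rewrite (jump_ext N j _ _ eta IH).
  assert (E : jump N j (fun xi => sumL l (fun a => c a * Lpow N j k (f a) xi)) eta
              = sumL l (fun a => c a * jump N j (Lpow N j k (f a)) eta)).
  { clear IH. induction l as [|a l IHl]; simpl; [now apply jump_const|].
    now rewrite jump_plus, jump_scal, IHl. }
  rewrite E, <- sumL_minus, <- sumL_scal. apply sumL_ext. intros a _.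
  rewrite Lgen_jump by easy. ring.
Qed.

Lemma Lpow_bound (N : nat) (j : R) (f : list bool -> R) (k : nat) (eta : list bool) :
  (1 <= N)%nat -> 0 < j -> length eta = (2 * N + 1)%nat ->
  (forall xi, length xi = (2 * N + 1)%nat -> Rabs (f xi) <= 1) ->
  Rabs (Lpow N j k f eta) <= (2 * total_rate N j) ^ k.
Proof.
  intros HN Hj He H. pose proof (total_rate_pos N j HN Hj) as HL.
  revert eta He. induction k as [|k IH]; intros eta He; [now apply H|].
  change (Rabs (Lgen N j (Lpow N j k f) eta) <= (2 * total_rate N j) ^ S k).
  rewrite Lgen_jump by easy. set (M := (2 * total_rate N j) ^ k) in *.
  assert (Hj1 : - M <= jpow N j 1 (Lpow N j k f) eta <= M).
  { apply jpow_bound; auto. intros xi Hxi. apply Rabs_le_between. now apply IH. }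
  change (jpow N j 1 (Lpow N j k f) eta) with (jump N j (Lpow N j k f) eta) in Hj1.
  pose proof (proj1 (Rabs_le_between _ _) (IH eta He)) as H2.
  rewrite Rabs_mult, (Rabs_pos_eq (total_rate N j)) by lra. cbn [pow]. fold M.
  assert (Rabs (jump N j (Lpow N j k f) eta - Lpow N j k f eta) <= 2 * M).
  { apply Rabs_le. lra. }
  nra.
Qed.

Lemma sumL_indicator (N : nat) (g : list bool -> R) (eta : list bool) :
  length eta = (2 * N + 1)%nat ->
  sumL (Conf N) (fun zeta => g zeta * indicator zeta eta) = g eta.
Proof.
  intros He. apply in_Conf in He. pose proof (NoDup_configs (2 * N + 1)) as Hd.
  fold (Conf N) in Hd. unfold indicator.
  induction (Conf N) as [|z l IH]; [easy|]. inversion_clear Hd. simpl.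
  destruct list_eq_dec as [<-|Hne].
  - rewrite (sumL_ext _ _ (fun _ => 0)), sumL_const; [lra|].
    intros a Ha. destruct list_eq_dec as [<-|]; [easy|lra].
  - destruct He as [->|He]; [easy|]. rewrite IH by easy. lra.
Qed.

Lemma is_series_sumL {A} (l : list A) (c v : A -> R) (u : A -> nat -> R) :
  (forall a, In a l -> is_series (u a) (v a)) ->
  is_series (fun k => sumL l (fun a => c a * u a k)) (sumL l (fun a => c a * v a)).
Proof.
  induction l as [|a l IH]; intros H; simpl.
  - apply is_series_Reals. intros eps Heps. exists 0%nat. intros n _.
    rewrite sum_eq_R0 by easy. unfold R_dist. rewrite Rminus_0_r, Rabs_R0. lra.
  - apply (is_series_plus (fun k => c a * u a k)).
    + apply (is_series_scal (c a) (u a)). apply H. now left.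
    + apply IH. intros b Hb. apply H. now right.
Qed.

Lemma is_series_exp (x : R) : is_series (fun k => x ^ k / INR (fact k)) (exp x).
Proof.
  generalize (is_exp_Reals x). apply is_series_ext. intros k.
  rewrite pow_n_pow. unfold scal. simpl. unfold mult. simpl. unfold Rdiv. ring.
Qed.

Lemma is_series_lin (u v : nat -> R) (c a b : R) :
  is_series u a -> is_series v b -> is_series (fun k => u k + c * v k) (a + c * b).
Proof.
  intros Hu Hv. apply (is_series_plus u (fun k => c * v k)); [easy|].
  now apply (is_series_scal c v).
Qed.

Lemma is_series_le_lim (u v : nat -> R) (a b : R) :
  (forall k, u k <= v k) -> is_series u a -> is_series v b -> a <= b.
Proof.
  intros H Hu Hv.
  change (Rbar_le a b). eapply is_lim_seq_le; [|exact Hu|exact Hv].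
  intros n. apply sum_n_m_le. exact H.
Qed.

(* The Cauchy product of [exp (lam t)] with the series defining [mu S_t f] is the
   Poisson mixture of the powers of the jump chain. *)
Lemma uniformization (N : nat) (j t a : R) (mu f : list bool -> R) :
  (1 <= N)%nat -> 0 < j -> 0 < t -> is_prob N mu ->
  (forall xi, length xi = (2 * N + 1)%nat -> Rabs (f xi) <= 1) ->
  is_series (fun k => t ^ k / INR (fact k) * pairing N mu (Lpow N j k f)) a ->
  is_series (fun k => (total_rate N j * t) ^ k / INR (fact k)
                      * pairing N mu (jpow N j k f)) (exp (total_rate N j * t) * a).
Proof.
  intros HN Hj Ht Hmu Hf Ha. pose proof (total_rate_pos N j HN Hj) as HL.
  set (lam := total_rate N j) in *.
  (* The Cauchy product needs absolute convergence. In the supremum norm the generator is at most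
     [2 * lam], so the exponential series at [2 * lam * t] dominates. *)
  assert (Habs : ex_series (fun k => Rabs (t ^ k / INR (fact k) * pairing N mu (Lpow N j k f)))).
  { apply (@ex_series_le R_AbsRing R_CompleteNormedModule)
      with (b := fun k => (2 * lam * t) ^ k / INR (fact k)).
    2:{ eexists. apply is_series_exp. }
    intros k. unfold norm. simpl. unfold abs. simpl. rewrite Rabs_Rabsolu, Rabs_mult.
    pose proof (INR_fact_lt_0 k). pose proof (pow_lt t k Ht).
    rewrite Rabs_pos_eq by (left; apply Rdiv_lt_0_compat; lra).
    assert (HB : Rabs (pairing N mu (Lpow N j k f)) <= (2 * lam) ^ k).
    { rewrite <- (Rminus_0_r (pairing _ _ _)). apply pairing_close; [easy|].
      intros eta He. rewrite Rminus_0_r. now apply Lpow_bound. }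
    rewrite Rpow_mult_distr.
    replace ((2 * lam) ^ k * t ^ k / INR (fact k))
      with (t ^ k / INR (fact k) * (2 * lam) ^ k) by (field; lra).
    apply Rmult_le_compat_l; [|easy]. left. apply Rdiv_lt_0_compat; lra. }
  pose proof (is_series_exp (lam * t)) as He.
  assert (Heabs : ex_series (fun k => Rabs ((lam * t) ^ k / INR (fact k)))).
  { eexists. eapply is_series_ext; [|exact He]. intros k. simpl.
    pose proof (INR_fact_lt_0 k). assert (0 < (lam * t) ^ k) by (apply pow_lt; nra).
    rewrite Rabs_pos_eq; [easy|]. left. apply Rdiv_lt_0_compat; lra. }
  rewrite (Rmult_comm (exp _)).
  generalize (is_series_mult _ _ _ _ Ha He Habs Heabs). apply is_series_ext.
  intros k.
  (* With Q the jump operator, lam Q = lam + L; this is the recurrence required of the numbers lam^k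
     mu(Q^k L^m f), used here at m = 0. *)
  assert (Hb := binomial_shift lam (fun k m => lam ^ k * pairing N mu (jpow N j k (Lpow N j m f)))
                  k 0).
  simpl in Hb. rewrite Rpow_mult_distr.
  match goal with |- ?x = ?y => change (@eq R x y) end.
  transitivity (t ^ k / INR (fact k) * (lam ^ k * pairing N mu (jpow N j k f))).
  2:{ field. apply INR_fact_neq_0. }
  rewrite Hb.
  - rewrite scal_sum. apply sum_eq. intros i Hi. unfold Binomial.C.
    rewrite Rpow_mult_distr.
    replace (t ^ k) with (t ^ i * t ^ (k - i)) by (rewrite <- pow_add; f_equal; lia).
    field. repeat split; apply INR_fact_neq_0.
  - clear k Hb. intros k m.
    change (lam * lam ^ k * pairing N mu (jpow N j (S k) (Lpow N j m f))
      = lam * (lam ^ k * pairing N mu (jpow N j k (Lpow N j m f)))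
        + lam ^ k * pairing N mu (jpow N j k (Lpow N j (S m) f))).
    rewrite jpow_succ_r.
    rewrite (pairing_ext N mu _ (fun eta => 1 * jpow N j k (Lpow N j m f) eta
                                  + / lam * jpow N j k (Lpow N j (S m) f) eta)).
    + rewrite pairing_lin. simpl. field. lra.
    + intros eta _. apply jpow_lin; auto. intros xi.
      change (Lpow N j (S m) f xi) with (Lgen N j (Lpow N j m f) xi).
      rewrite Lgen_jump by easy. fold lam. field. lra.
Qed.

(** Testing against the sign [s] of [nu - pist] turns the norm into a single difference of averages.
    The mean of [K * th ^ k] over a Poisson number k of jumps with mean lam t is K exp(-lam t (1 -
    th)). *)
Lemma tvnorm_le_of_contracts (N : nat) (j K th t : R) (mu pist nu : list bool -> R) :
  (1 <= N)%nat -> 0 < j -> 0 < t -> contracts N j K th ->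
  is_prob N mu -> is_prob N pist -> stationary N j pist -> law_at N j mu t nu ->
  tvnorm N (fun eta => nu eta - pist eta) <= K * exp (- (total_rate N j * (1 - th)) * t).
Proof.
  intros HN Hj Ht HC Hmu Hpi Hst Hlaw.
  pose proof (total_rate_pos N j HN Hj) as HL. set (lam := total_rate N j) in *.
  pose (s := fun zeta => if Rle_dec 0 (nu zeta - pist zeta) then 1 else -1).
  assert (Hs : forall xi, length xi = (2 * N + 1)%nat -> Rabs (s xi) <= 1).
  { intros xi _. unfold s. destruct Rle_dec; [rewrite Rabs_R1; lra|].
    rewrite Rabs_left; lra. }
  set (a := sumL (Conf N) (fun zeta => s zeta * nu zeta)).
  assert (Htv : tvnorm N (fun eta => nu eta - pist eta) = a - pairing N pist s).
  { unfold tvnorm, a, pairing. rewrite <- sumL_minus. apply sumL_ext. intros z _.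
    unfold s. destruct Rle_dec; [rewrite Rabs_pos_eq|rewrite Rabs_left]; lra. }
  (* [law_at] provides the series for indicators only; [s] is a finite combination of them. *)
  assert (Ha : is_series (fun k => t ^ k / INR (fact k) * pairing N mu (Lpow N j k s)) a).
  { eapply is_series_ext.
    2:{ apply (is_series_sumL (Conf N) s nu
          (fun zeta k => t ^ k / INR (fact k) * pairing N mu (Lpow N j k (indicator zeta)))).
        intros z Hz. apply is_series_Reals. exact (Hlaw z Hz). }
    intros k. simpl.
    match goal with |- ?x = ?y => change (@eq R x y) end.
    rewrite (pairing_ext N mu (Lpow N j k s)
      (fun eta => sumL (Conf N) (fun zeta => s zeta * Lpow N j k (indicator zeta) eta))).
    - unfold pairing.
      rewrite (sumL_ext (Conf N) (fun eta => mu eta * _)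
        (fun eta => sumL (Conf N) (fun zeta => s zeta *
                      (mu eta * Lpow N j k (indicator zeta) eta)))).
      + rewrite sumL_exchange, <- sumL_scal. apply sumL_ext. intros z _.
        rewrite sumL_scal. ring.
      + intros eta _. rewrite <- sumL_scal. apply sumL_ext. intros; ring.
    - intros eta He. rewrite <- Lpow_sumL by easy. apply Lpow_eq_on_conf; auto.
      intros xi Hxi. now rewrite sumL_indicator. }
  pose proof (uniformization N j t a mu s HN Hj Ht Hmu Hs Ha) as Hu. fold lam in Hu.
  set (p := pairing N pist s) in *.
  assert (Hle : exp (lam * t) * a + (- p) * exp (lam * t) <= K * exp (lam * t * th)).
  { eapply is_series_le_lim.
    2:{ exact (is_series_lin _ _ (- p) _ _ Hu (is_series_exp (lam * t))). }
    2:{ exact (is_series_scal K (_ : nat -> R) _ (is_series_exp (lam * t * th))). }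
    intros k.
    assert (0 < (lam * t) ^ k / INR (fact k)).
    { apply Rdiv_lt_0_compat; [apply pow_lt; nra|apply INR_fact_lt_0]. }
    pose proof (contracts_stationary N j K th mu pist s k HN Hj HC Hmu Hpi Hst Hs) as Hk.
    fold p in Hk. apply Rabs_le_between in Hk.
    match goal with |- _ <= ?y => change y with (K * ((lam * t * th) ^ k / INR (fact k))) end.
    rewrite (Rpow_mult_distr (lam * t) th).
    replace (K * ((lam * t) ^ k * th ^ k / INR (fact k)))
      with ((lam * t) ^ k / INR (fact k) * (K * th ^ k))
      by (field; apply INR_fact_neq_0).
    nra. }
  rewrite Htv.
  replace (- (lam * (1 - th)) * t) with (lam * t * th + - (lam * t)) by ring.
  rewrite exp_plus, exp_Ropp.
  pose proof (exp_pos (lam * t)).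
  apply Rmult_le_reg_l with (exp (lam * t)); [easy|].
  replace (exp (lam * t) * (K * (exp (lam * t * th) * / exp (lam * t))))
    with (K * exp (lam * t * th)) by (field; lra).
  lra.
Qed.

(** * Doeblin's argument for a fixed size *)

(** The sum over the holes of their distances to a point just beyond the right end; it vanishes only
    when every site is occupied. *)
Fixpoint hole_weight (l : list bool) : nat :=
  match l with
  | nil => 0
  | b :: l' => (if b then 0 else S (length l')) + hole_weight l'
  end.

Lemma hole_weight_app (p l m : list bool) : length l = length m ->
  (hole_weight l < hole_weight m)%nat -> (hole_weight (p ++ l) < hole_weight (p ++ m))%nat.
Proof.
  intros E H. induction p as [|b p IH]; [easy|]. simpl.
  rewrite !length_app, E. lia.
Qed.

Lemma hole_weight_le (l : list bool) : (hole_weight l <= length l * length l)%nat.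
Proof. induction l as [|b l IH]; simpl; [easy|]. destruct b; nia. Qed.

Lemma hole_weight_full (l : list bool) : hole_weight l = 0%nat -> l = repeat true (length l).
Proof.
  induction l as [|b l IH]; simpl; [easy|]. destruct b; simpl; [|lia].
  intros H. f_equal. now apply IH.
Qed.

Lemma hole_cases (l : list bool) :
  hole_weight l = 0%nat \/ (exists p, l = p ++ [false])
  \/ exists p q, l = p ++ false :: true :: q.
Proof.
  induction l as [|b l [H|[(p & ->)|(p & q & ->)]]]; [now left| | |].
  - destruct b; [now left|right].
    apply hole_weight_full in H. rewrite H. destruct (length l) as [|n].
    + left. now exists [].
    + right. now exists [], (repeat true n).
  - right. left. now exists (b :: p).
  - right. right. now exists (b :: p), q.
Qed.

(** A hole followed by a particle moves right by an exchange, and a hole at the last site is filled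
    by injection. For the full configuration the truncated [0 - 1] is 0, and injection changes
    nothing. *)
Lemma event_toward_full (N : nat) (eta : list bool) : (1 <= N)%nat ->
  length eta = (2 * N + 1)%nat ->
  (exists i, (i < 2 * N)%nat /\ (hole_weight (swap eta i (i + 1)) < hole_weight eta)%nat)
  \/ (hole_weight (inject N eta) <= hole_weight eta - 1)%nat.
Proof.
  intros HN He. destruct (hole_cases eta) as [H|[(p & ->)|(p & q & ->)]].
  - right. pose proof (hole_weight_full _ H) as E. rewrite He in E. unfold inject.
    rewrite E, !nth_repeat_lt by lia. rewrite <- E. lia.
  - right. rewrite length_app in He. simpl in He. unfold inject, flip.
    replace (2 * N)%nat with (length p) by lia.
    rewrite nth_middle, upd_app.
    assert (hole_weight (p ++ [true]) < hole_weight (p ++ [false]))%nat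
      by (apply hole_weight_app; simpl; lia).
    simpl. lia.
  - left. exists (length p). rewrite length_app in He. simpl in He. split; [lia|].
    unfold swap. rewrite nth_middle, upd_app.
    replace (p ++ false :: true :: q) with ((p ++ [false]) ++ true :: q)
      by (now rewrite <- app_assoc).
    replace (length p + 1)%nat with (length (p ++ [false])) by (rewrite length_app; easy).
    rewrite nth_middle.
    replace (p ++ true :: true :: q) with ((p ++ [true]) ++ true :: q)
      by (now rewrite <- app_assoc).
    replace (length (p ++ [false])) with (length (p ++ [true])) by (rewrite !length_app; easy).
    rewrite upd_app.
    rewrite <- !app_assoc. apply hole_weight_app; simpl; lia.
Qed.

Lemma sumL_ge_term {A} (l : list A) (f : A -> R) (a : A) : In a l ->
  (forall b, In b l -> 0 <= f b) -> f a <= sumL l f.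
Proof.
  induction l as [|b l IH]; [easy|]. simpl. intros [->|Ha] H.
  - assert (0 <= sumL l f).
    { rewrite <- (Rmult_0_r (INR (length l))), <- sumL_const. apply sumL_le.
      intros c Hc. apply H. now right. }
    lra.
  - assert (f a <= sumL l f) by (apply IH; auto). specialize (H b (or_introl eq_refl)). lra.
Qed.

Definition min_prob (N : nat) (j : R) : R := Rmin (/ 2) (brate N j) / total_rate N j.

Lemma min_prob_bounds (N : nat) (j : R) : (1 <= N)%nat -> 0 < j ->
  0 < min_prob N j <= / 2.
Proof.
  intros HN Hj. pose proof (total_rate_pos N j HN Hj). pose proof (brate_pos N j HN Hj).
  assert (1 <= total_rate N j).
  { unfold total_rate. apply le_INR in HN. simpl in HN. lra. }
  unfold min_prob. assert (0 < Rmin (/ 2) (brate N j)) by (apply Rmin_pos; lra).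
  pose proof (Rmin_l (/ 2) (brate N j)).
  split; [apply Rdiv_lt_0_compat; lra|].
  apply Rmult_le_reg_r with (total_rate N j); [easy|].
  unfold Rdiv. rewrite Rmult_assoc, Rinv_l by lra. nra.
Qed.

Lemma jump_ge_event (N : nat) (j : R) (h : list bool -> R) (eta xi : list bool) :
  (1 <= N)%nat -> 0 < j -> length eta = (2 * N + 1)%nat ->
  (forall z, length z = (2 * N + 1)%nat -> 0 <= h z) ->
  (xi = inject N eta \/ exists i, (i < 2 * N)%nat /\ xi = swap eta i (i + 1)) ->
  min_prob N j * h xi <= jump N j h eta.
Proof.
  intros HN Hj He Hh Hxi. pose proof (total_rate_pos N j HN Hj). pose proof (brate_pos N j HN Hj).
  unfold min_prob, jump, Rdiv. rewrite (Rmult_comm (Rmin _ _)), Rmult_assoc.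
  apply Rmult_le_compat_l; [left; now apply Rinv_0_lt_compat|].
  assert (0 <= h (inject N eta)) by (apply Hh; now rewrite inject_length).
  assert (0 <= h (remove_first eta)) by (apply Hh; now rewrite remove_first_length).
  assert (Hs : forall i, 0 <= h (swap eta i (i + 1))) by (intros; apply Hh; now rewrite swap_length).
  pose proof (Rmin_l (/ 2) (brate N j)). pose proof (Rmin_r (/ 2) (brate N j)).
  destruct Hxi as [->|(i & Hi & ->)].
  - assert (0 <= sumL (seq 0 (2 * N)) (fun i => h (swap eta i (i + 1)))).
    { rewrite <- (Rmult_0_r (INR (length (seq 0 (2 * N))))), <- sumL_const.
      apply sumL_le. auto. }
    nra.
  - assert (h (swap eta i (i + 1)) <= sumL (seq 0 (2 * N)) (fun i => h (swap eta i (i + 1)))).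
    { apply (sumL_ge_term _ (fun i => h (swap eta i (i + 1)))); auto. apply in_seq. lia. }
    specialize (Hs i). nra.
Qed.

(** Injection fixes the full configuration, so [m] may exceed the weight, and one number of steps
    serves all starting configurations. *)
Lemma jpow_reaches_full (N : nat) (j : R) (h : list bool -> R) (m : nat) (eta : list bool) :
  (1 <= N)%nat -> 0 < j -> length eta = (2 * N + 1)%nat ->
  (forall z, length z = (2 * N + 1)%nat -> 0 <= h z) -> (hole_weight eta <= m)%nat ->
  min_prob N j ^ m * h (repeat true (2 * N + 1)) <= jpow N j m h eta.
Proof.
  intros HN Hj He Hh. revert eta He. pose proof (min_prob_bounds N j HN Hj) as Hd.
  induction m as [|m IH]; intros eta He Hm.
  - assert (E : hole_weight eta = 0%nat) by lia. apply hole_weight_full in E.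
    rewrite He in E. rewrite E. simpl. lra.
  - change (jpow N j (S m) h eta) with (jump N j (jpow N j m h) eta).
    assert (H0 : forall z, length z = (2 * N + 1)%nat -> 0 <= jpow N j m h z).
    { clear IH Hm. induction m as [|m IH]; intros z Hz; [now apply Hh|].
      change (jpow N j (S m) h z) with (jump N j (jpow N j m h) z).
      rewrite <- (jump_const N j 0 z HN Hj). apply jump_le; auto. }
    assert (Hstep : exists xi, length xi = (2 * N + 1)%nat /\ (hole_weight xi <= m)%nat /\
      (xi = inject N eta \/ exists i, (i < 2 * N)%nat /\ xi = swap eta i (i + 1))).
    { destruct (event_toward_full N eta HN He) as [(i & Hi & Hw)|Hw].
      - exists (swap eta i (i + 1)). rewrite swap_length. repeat split; eauto; lia.
      - exists (inject N eta). rewrite inject_length. repeat split; eauto; lia. }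
    destruct Hstep as (xi & Hlx & Hwx & Hxi).
    eapply Rle_trans; [|apply (jump_ge_event N j _ eta xi HN Hj He H0 Hxi)].
    cbn [pow]. rewrite Rmult_assoc. apply Rmult_le_compat_l; [lra|]. now apply IH.
Qed.

Lemma bernoulli_sub (x : R) (n : nat) : 0 <= x <= 1 -> 1 - INR n * x <= (1 - x) ^ n.
Proof.
  intros Hx. induction n as [|n IH]; [simpl; lra|]. rewrite S_INR. cbn [pow].
  pose proof (pos_INR n). nra.
Qed.

Lemma contracts_each_size (N : nat) (j : R) : (1 <= N)%nat -> 0 < j ->
  exists K th, 0 <= K /\ 0 < th < 1 /\ contracts N j K th.
Proof.
  intros HN Hj. pose proof (min_prob_bounds N j HN Hj) as Hd.
  (* [m] bounds every hole weight. By Bernoulli, [th = 1 - d / m] has [th ^ m] at least [1 - d], so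
     a factor [1 - d] every [m] steps is geometric decay with ratio [th]; the constant [2 / th ^ m]
     covers the first [m] steps. *)
  set (m := ((2 * N + 1) * (2 * N + 1))%nat).
  assert (Hm : (1 <= m)%nat) by (unfold m; nia).
  set (d := min_prob N j ^ m).
  assert (Hd01 : 0 < d <= / 2).
  { unfold d. split; [apply pow_lt; lra|]. destruct m as [|m']; [lia|]. simpl.
    assert (min_prob N j ^ m' <= 1 ^ m') by (apply pow_incr; lra).
    assert (0 < min_prob N j ^ m') by (apply pow_lt; lra).
    rewrite pow1 in H. nra. }
  assert (HmR : 1 <= INR m) by (apply le_INR in Hm; exact Hm).
  set (th := 1 - d / INR m).
  assert (Hdm : 0 < d / INR m <= / 2).
  { split; [apply Rdiv_lt_0_compat; lra|].
    apply Rmult_le_reg_r with (INR m); [lra|]. unfold Rdiv.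
    rewrite Rmult_assoc, Rinv_l by lra. nra. }
  assert (Hth : 0 < th < 1) by (unfold th; lra).
  assert (Hthm : 1 - d <= th ^ m).
  { eapply Rle_trans; [|apply bernoulli_sub; lra]. right. field. lra. }
  assert (Hpos : forall k, 0 < th ^ k) by (intros; apply pow_lt; lra).
  exists (2 / th ^ m), th. split; [left; apply Rdiv_lt_0_compat; auto; lra|].
  split; [easy|]. intros f Hf.
  assert (HI : forall k, exists lo hi, 0 <= hi - lo <= 2 / th ^ m * th ^ k /\
    forall z, length z = (2 * N + 1)%nat -> lo <= jpow N j k f z <= hi).
  { intros k. induction k as [k IH] using (well_founded_ind Nat.lt_wf_0).
    destruct (Nat.lt_ge_cases k m) as [Hk|Hk].
    - exists (-1), 1. split.
      + split; [lra|]. apply Rmult_le_reg_r with (th ^ m); [auto|].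
        replace (2 / th ^ m * th ^ k * th ^ m) with (2 * th ^ k)
          by (field; apply Rgt_not_eq, Hpos).
        replace m with (k + (m - k))%nat at 1 by lia. rewrite pow_add.
        assert (th ^ (m - k) <= 1 ^ (m - k)) by (apply pow_incr; lra).
        rewrite pow1 in H. specialize (Hpos k). nra.
      + intros z Hz. apply jpow_bound; auto. intros xi Hxi. apply Rabs_le_between; auto.
    - destruct (IH (k - m)%nat ltac:(lia)) as (lo & hi & Hw & Hb).
      set (g := jpow N j (k - m) f) in *.
      set (c := g (repeat true (2 * N + 1))).
      (* After [m] steps every start gives the full configuration mass at least [d], so both ends of
         the range move toward its value [c] by the fraction [d] of their distance. *)
      exists (lo + d * (c - lo)), (hi - d * (hi - c)). split.
      + replace (hi - d * (hi - c) - (lo + d * (c - lo))) with ((1 - d) * (hi - lo)) by ring.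
        replace k with (m + (k - m))%nat by lia. rewrite pow_add.
        split; [nra|].
        apply Rle_trans with (th ^ m * (hi - lo)); [nra|].
        replace (2 / th ^ m * (th ^ m * th ^ (k - m)))
          with (th ^ m * (2 / th ^ m * th ^ (k - m))) by ring.
        apply Rmult_le_compat_l; [left; auto|]. lra.
      + intros z Hz.
        assert (E : jpow N j k f = jpow N j m g).
        { replace k with (m + (k - m))%nat at 1 by lia. apply Nat.iter_add. }
        rewrite E.
        assert (Hwz : (hole_weight z <= m)%nat).
        { eapply Nat.le_trans; [apply hole_weight_le|]. rewrite Hz. easy. }
        assert (Hone : jpow N j m (fun _ => 1) z = 1).
        { pose proof (jpow_bound N j 1 1 (fun _ => 1) m z HN Hj Hz) as H1.
          assert (1 <= jpow N j m (fun _ => 1) z <= 1) by (apply H1; intros; lra). lra. }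
        split.
        * assert (H1 := jpow_reaches_full N j (fun x => g x - lo) m z HN Hj Hz
            ltac:(intros x Hx; specialize (Hb x Hx); lra) Hwz).
          rewrite (jpow_lin N j 1 (- lo) g (fun _ => 1)) in H1
            by (auto; intros; ring).
          fold c d in H1. rewrite Hone in H1. lra.
        * assert (H1 := jpow_reaches_full N j (fun x => hi - g x) m z HN Hj Hz
            ltac:(intros x Hx; specialize (Hb x Hx); lra) Hwz).
          rewrite (jpow_lin N j (-1) hi g (fun _ => 1)) in H1
            by (auto; intros; ring).
          fold c d in H1. rewrite Hone in H1. lra. }
  intros k eta xi Heta Hxi. destruct (HI k) as (lo & hi & Hw & Hb).
  pose proof (Hb eta Heta). pose proof (Hb xi Hxi). apply Rabs_le. lra.
Qed.

(** * The pair potential *)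

Lemma ln_le_sub_1 (x : R) : 0 < x -> ln x <= x - 1.
Proof.
  intros Hx. rewrite <- (ln_exp (x - 1)). apply ln_le; [easy|].
  pose proof (exp_ineq1_le (x - 1)). lra.
Qed.

Lemma ln_ratio_le (x y : R) : 0 < x -> 0 < y -> ln x - ln y <= (x - y) / y.
Proof.
  intros Hx Hy. rewrite <- ln_div by easy.
  replace ((x - y) / y) with (x / y - 1) by (field; lra).
  apply ln_le_sub_1. now apply Rdiv_lt_0_compat.
Qed.

(** At the point (P, Q) relative to the pole, the four neighbours of the value t carry t + 1 plus or
    minus 2P or 2Q. For fixed t their product is largest when P^2 = Q^2, where it equals (t^2 +
    3)^2. *)
Lemma ln_four_neighbours (P Q t : R) : t = P ^ 2 + Q ^ 2 + 1 ->
  ln (t + 1 - 2 * P) + ln (t + 1 + 2 * P) + ln (t + 1 - 2 * Q) + ln (t + 1 + 2 * Q)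
    - 4 * ln t <= 6 / t ^ 2.
Proof.
  intros Ht.
  assert (H1 : 0 < t + 1 - 2 * P) by nra. assert (H2 : 0 < t + 1 + 2 * P) by nra.
  assert (H3 : 0 < t + 1 - 2 * Q) by nra. assert (H4 : 0 < t + 1 + 2 * Q) by nra.
  assert (H0 : 0 < t) by nra. assert (Hs : 0 < t ^ 2) by (apply pow_lt; easy).
  rewrite <- !ln_mult by (repeat apply Rmult_lt_0_compat; easy).
  assert (Hprod : (t + 1 - 2 * P) * (t + 1 + 2 * P) * (t + 1 - 2 * Q) * (t + 1 + 2 * Q)
                  <= (t ^ 2 + 3) ^ 2).
  { assert (HPQ : 4 * (P ^ 2 * Q ^ 2) <= (P ^ 2 + Q ^ 2) ^ 2)
      by (pose proof (pow2_ge_0 (P ^ 2 - Q ^ 2)); nra).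
    assert (HPQ' : 4 * (P ^ 2 * Q ^ 2) <= (t - 1) ^ 2)
      by (replace (t - 1) with (P ^ 2 + Q ^ 2) by lra; exact HPQ).
    replace ((t + 1 - 2 * P) * (t + 1 + 2 * P) * (t + 1 - 2 * Q) * (t + 1 + 2 * Q))
      with ((t + 1) ^ 4 - 4 * (P ^ 2 + Q ^ 2) * (t + 1) ^ 2 + 16 * (P ^ 2 * Q ^ 2)) by ring.
    replace (P ^ 2 + Q ^ 2) with (t - 1) by lra.
    replace ((t ^ 2 + 3) ^ 2)
      with ((t + 1) ^ 4 - 4 * (t - 1) * (t + 1) ^ 2 + 4 * (t - 1) ^ 2) by ring.
    lra. }
  apply ln_le in Hprod; [|repeat apply Rmult_lt_0_compat; easy].
  replace ((t ^ 2 + 3) ^ 2) with ((t ^ 2 + 3) * (t ^ 2 + 3)) in Hprod by ring.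
  rewrite (ln_mult (t ^ 2 + 3) (t ^ 2 + 3)) in Hprod by lra.
  pose proof (ln_ratio_le (t ^ 2 + 3) (t ^ 2) ltac:(lra) Hs) as Hr.
  replace ((t ^ 2 + 3 - t ^ 2) / t ^ 2) with (3 / t ^ 2) in Hr by (field; lra).
  replace (ln (t ^ 2)) with (2 * ln t) in Hr
    by (replace (t ^ 2) with (t * t) by ring; rewrite ln_mult by easy; ring).
  replace (6 / t ^ 2) with (2 * (3 / t ^ 2)) by (field; lra). lra.
Qed.

(** Opposite neighbours multiply to [A] and [B], whose sum depends on t only, and 1/A + 1/B is at
    least 4/(A + B). The bound is of size 4/t^2, so three copies outweigh the 6/t^2 of the logarithm
    once t is large. *)
Lemma inv_four_neighbours (P Q t : R) : t = P ^ 2 + Q ^ 2 + 1 ->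
  4 * (t - 3) / (t * (t ^ 2 + 3)) <=
  / (t + 1 - 2 * P) + / (t + 1 + 2 * P) + / (t + 1 - 2 * Q) + / (t + 1 + 2 * Q) - 4 * / t.
Proof.
  intros Ht.
  assert (H1 : 0 < t + 1 - 2 * P) by nra. assert (H2 : 0 < t + 1 + 2 * P) by nra.
  assert (H3 : 0 < t + 1 - 2 * Q) by nra. assert (H4 : 0 < t + 1 + 2 * Q) by nra.
  assert (H0 : 0 < t) by nra.
  set (A := (t + 1 - 2 * P) * (t + 1 + 2 * P)). set (B := (t + 1 - 2 * Q) * (t + 1 + 2 * Q)).
  assert (HA : 0 < A) by (now apply Rmult_lt_0_compat).
  assert (HB : 0 < B) by (now apply Rmult_lt_0_compat).
  assert (HAB : A + B = 2 * (t ^ 2 + 3)).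
  { unfold A, B.
    replace ((t + 1 - 2 * P) * (t + 1 + 2 * P)) with ((t + 1) ^ 2 - 4 * P ^ 2) by ring.
    replace (P ^ 2) with (t - 1 - Q ^ 2) by lra. ring. }
  replace (/ (t + 1 - 2 * P) + / (t + 1 + 2 * P) + / (t + 1 - 2 * Q) + / (t + 1 + 2 * Q))
    with (2 * (t + 1) * (/ A + / B)) by (unfold A, B; field; lra).
  assert (Hh : 4 / (A + B) <= / A + / B).
  { apply Rmult_le_reg_r with (A * B * (A + B)); [repeat apply Rmult_lt_0_compat; lra|].
    replace (4 / (A + B) * (A * B * (A + B))) with (4 * (A * B)) by (field; lra).
    replace ((/ A + / B) * (A * B * (A + B))) with ((A + B) ^ 2) by (field; lra).
    pose proof (pow2_ge_0 (A - B)). nra. }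
  rewrite HAB in Hh.
  replace (4 * (t - 3) / (t * (t ^ 2 + 3)))
    with (2 * (t + 1) * (4 / (2 * (t ^ 2 + 3))) - 4 * / t) by (field; split; nra).
  nra.
Qed.

(** On the edge one neighbour is missing; its absence gives the logarithm a gain of order 1/t, which
    exceeds the lattice error. *)
Lemma ln_inv_edge (Q t : R) : t = Q ^ 2 + 1 ->
  (t ^ 2 - 3 * t - 5) / t ^ 3 + 3 * (/ (t + 1) + 2 * (t + 1) / (t ^ 2 - 2 * t + 5) - 3 / t) <=
  - (ln (t + 1) + ln (t + 1 - 2 * Q) + ln (t + 1 + 2 * Q) - 3 * ln t)
  + 3 * (/ (t + 1) + / (t + 1 - 2 * Q) + / (t + 1 + 2 * Q) - 3 * / t).
Proof.
  intros Ht.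
  assert (H3 : 0 < t + 1 - 2 * Q) by nra. assert (H4 : 0 < t + 1 + 2 * Q) by nra.
  assert (H0 : 0 < t) by nra. assert (H5 : 0 < t ^ 3) by (apply pow_lt; easy).
  assert (HQ : (t + 1 - 2 * Q) * (t + 1 + 2 * Q) = t ^ 2 - 2 * t + 5).
  { replace ((t + 1 - 2 * Q) * (t + 1 + 2 * Q)) with ((t + 1) ^ 2 - 4 * Q ^ 2) by ring.
    replace (Q ^ 2) with (t - 1) by lra. ring. }
  replace (/ (t + 1) + / (t + 1 - 2 * Q) + / (t + 1 + 2 * Q) - 3 * / t)
    with (/ (t + 1) + 2 * (t + 1) / ((t + 1 - 2 * Q) * (t + 1 + 2 * Q)) - 3 / t)
    by (field; lra).
  rewrite HQ, Rplus_assoc, <- ln_mult, HQ, <- ln_mult by nra.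
  assert (Hr := ln_ratio_le ((t + 1) * (t ^ 2 - 2 * t + 5)) (t ^ 3) ltac:(nra) H5).
  replace (((t + 1) * (t ^ 2 - 2 * t + 5) - t ^ 3) / t ^ 3)
    with (- ((t ^ 2 - 3 * t - 5) / t ^ 3)) in Hr by (field; lra).
  replace (ln (t ^ 3)) with (3 * ln t) in Hr.
  2:{ replace (t ^ 3) with (t * t * t) by ring. rewrite !ln_mult by nra. ring. }
  lra.
Qed.

(** [x] and [y] belong to the two neighbours of a diagonal point. Their mean is t, so the inverses
    contribute a nonnegative amount by convexity, and the gain is the concavity of the logarithm. *)
Lemma ln_inv_diagonal (x y t : R) : 0 < x -> 0 < y -> 0 < t ->
  x + y = 2 * t -> x * y = t ^ 2 - (2 * t - 3) ->
  (2 * t - 3) / t ^ 2 <= - (ln x + ln y - 2 * ln t) + 3 * (/ x + / y - 2 * / t).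
Proof.
  intros Hx Hy Ht Hs Hp. assert (H2 : 0 < t ^ 2) by (apply pow_lt; easy).
  assert (Hxy : 0 < x * y) by (apply Rmult_lt_0_compat; easy).
  pose proof (ln_ratio_le (x * y) (t ^ 2) Hxy H2) as Hr.
  replace ((x * y - t ^ 2) / t ^ 2) with (- ((2 * t - 3) / t ^ 2)) in Hr
    by (rewrite Hp; field; lra).
  replace (ln (t ^ 2)) with (2 * ln t) in Hr
    by (replace (t ^ 2) with (t * t) by ring; rewrite ln_mult by easy; ring).
  rewrite ln_mult in Hr by easy.
  assert (0 <= / x + / y - 2 * / t); [|lra].
  replace (/ x + / y - 2 * / t) with ((t * (x + y) - 2 * (x * y)) / (t * (x * y)))
    by (field; lra).
  rewrite Hs.
  replace (t * (2 * t) - 2 * (x * y)) with ((x - y) ^ 2 / 2)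
    by (replace t with ((x + y) / 2) by lra; field).
  apply Rmult_le_pos; [pose proof (pow2_ge_0 (x - y)); lra|].
  left. apply Rinv_0_lt_compat. now apply Rmult_lt_0_compat.
Qed.

(** * The potential and its discrete Laplacian *)

Definition dist2 (a b : nat) : R := INR a ^ 2 + (INR b - 2) ^ 2 + 1.

(* [a < b] are the distances of the two particles from an end.  Centring [dist2] at (0, 2)
   instead of the corner (0, 1) makes [- ln] subharmonic on the edge [a = 0] and on the
   diagonal [b = a + 1]; [3 / dist2] absorbs the lattice error of the logarithm; the linear
   term spreads a Laplacian of order N^-2 over the bulk; the exponential repairs a bounded
   region around the corner. *)
Definition pot (N a b : nat) : R :=
  ln (9 * INR N ^ 2) - ln (dist2 a b) + 3 * / dist2 a b + dist2 a b / (9 * INR N ^ 2)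
  + 1000000 * (/ 5) ^ (a + b).

Lemma dist2_ge_1 (a b : nat) : 1 <= dist2 a b.
Proof.
  unfold dist2. pose proof (pow2_ge_0 (INR a)). pose proof (pow2_ge_0 (INR b - 2)). lra.
Qed.

Lemma pow_fifth_pos (n : nat) : 0 < (/ 5) ^ n.
Proof. apply pow_lt. lra. Qed.

Lemma pow_fifth_antitone (m n : nat) : (m <= n)%nat -> (/ 5) ^ n <= (/ 5) ^ m.
Proof.
  intros H. replace n with (m + (n - m))%nat by lia. rewrite pow_add.
  assert ((/ 5) ^ (n - m) <= 1 ^ (n - m)) by (apply pow_incr; lra).
  rewrite pow1 in H0. pose proof (pow_fifth_pos m). nra.
Qed.

Lemma Nsqr_pos (N : nat) : (1 <= N)%nat -> 1 <= INR N ^ 2.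
Proof. intros H. apply le_INR in H. simpl in H. nra. Qed.

(** Only the linear term grows with the distance, at slope 1/(9 N^2); as long as [dist2] stays below
    9 N^2 the logarithm falls at least as fast. *)
Lemma pot_antitone (N a b a' b' : nat) : (1 <= N)%nat ->
  dist2 a b <= dist2 a' b' -> dist2 a' b' <= 9 * INR N ^ 2 -> (a + b <= a' + b')%nat ->
  pot N a' b' <= pot N a b.
Proof.
  intros HN H1 H2 H3. unfold pot. apply pow_fifth_antitone in H3.
  pose proof (dist2_ge_1 a b). pose proof (dist2_ge_1 a' b'). pose proof (Nsqr_pos N HN).
  set (t := dist2 a b) in *. set (t' := dist2 a' b') in *. set (k := 9 * INR N ^ 2) in *.
  assert (Hl := ln_ratio_le t t' ltac:(lra) ltac:(lra)).
  assert (/ t' <= / t) by (apply Rinv_le_contravar; lra).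
  assert (Hk : (t' - t) / k <= (t' - t) / t').
  { apply Rmult_le_compat_l; [lra|]. apply Rinv_le_contravar; lra. }
  replace ((t - t') / t') with (- ((t' - t) / t')) in Hl by (field; lra).
  replace ((t' - t) / k) with (t' / k - t / k) in Hk by (field; unfold k; lra).
  lra.
Qed.

Lemma pot_nonneg (N a b : nat) : (1 <= N)%nat -> dist2 a b <= 9 * INR N ^ 2 -> 0 <= pot N a b.
Proof.
  intros HN H. unfold pot. pose proof (dist2_ge_1 a b). pose proof (Nsqr_pos N HN).
  assert (ln (dist2 a b) <= ln (9 * INR N ^ 2)) by (apply ln_le; lra).
  assert (0 < / dist2 a b) by (apply Rinv_0_lt_compat; lra).
  assert (0 < dist2 a b / (9 * INR N ^ 2)) by (apply Rdiv_lt_0_compat; lra).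
  pose proof (pow_fifth_pos (a + b)). lra.
Qed.

Lemma pot_interior (N p q : nat) : (1 <= N)%nat -> (p + 2 <= q)%nat ->
  / (16 * INR N ^ 2) <=
  pot N p (S q) + pot N (S (S p)) (S q) + pot N (S p) q + pot N (S p) (S (S q))
  - 4 * pot N (S p) (S q).
Proof.
  intros HN Hpq. pose proof (Nsqr_pos N HN) as HN2.
  assert (HN1 : 1 <= INR N) by (apply le_INR in HN; exact HN).
  set (P := INR (S p)). set (Q := INR (S q) - 2). set (t := dist2 (S p) (S q)).
  assert (Ht : t = P ^ 2 + Q ^ 2 + 1) by reflexivity.
  pose proof (dist2_ge_1 (S p) (S q)) as Ht1. fold t in Ht1.
  pose proof (ln_four_neighbours P Q t Ht) as HL.
  pose proof (inv_four_neighbours P Q t Ht) as HI.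
  assert (E1 : dist2 p (S q) = t + 1 - 2 * P)
    by (unfold t, dist2, P, Q; rewrite !S_INR; ring).
  assert (E2 : dist2 (S (S p)) (S q) = t + 1 + 2 * P)
    by (unfold t, dist2, P, Q; rewrite !S_INR; ring).
  assert (E3 : dist2 (S p) q = t + 1 - 2 * Q)
    by (unfold t, dist2, P, Q; rewrite !S_INR; ring).
  assert (E4 : dist2 (S p) (S (S q)) = t + 1 + 2 * Q)
    by (unfold t, dist2, P, Q; rewrite !S_INR; ring).
  unfold pot. rewrite E1, E2, E3, E4. fold t.
  set (w := (/ 5) ^ (S p + S q)). pose proof (pow_fifth_pos (S p + S q)) as Hw. fold w in Hw.
  replace ((/ 5) ^ (p + S q)) with (5 * w)
    by (unfold w; cbn [Nat.add pow]; field).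
  replace ((/ 5) ^ (S p + q)) with (5 * w)
    by (unfold w; rewrite !Nat.add_succ_r; cbn [Nat.add pow]; field).
  replace ((/ 5) ^ (S (S p) + S q)) with (/ 5 * w) by (unfold w; cbn [Nat.add pow]; field).
  replace ((/ 5) ^ (S p + S (S q))) with (/ 5 * w)
    by (unfold w; rewrite !Nat.add_succ_r; cbn [Nat.add pow]; field).
  (* For t >= 7 the logarithm and the inverse suffice. For smaller t the two indices sum to at most
     6, and the exponential, whose Laplacian is (5 + 5 + 1/5 + 1/5 - 4) * 1000000 times [w], covers
     a deficit of at most 12. *)
  assert (Hcore : 0 <= - (6 / t ^ 2) + 3 * (4 * (t - 3) / (t * (t ^ 2 + 3))) + 6400000 * w).
  { replace (- (6 / t ^ 2) + 3 * (4 * (t - 3) / (t * (t ^ 2 + 3))))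
      with ((12 * (t - 3) * t - 6 * (t ^ 2 + 3)) / (t ^ 2 * (t ^ 2 + 3))) by (field; nra).
    assert (Ht2 : t <= t ^ 2) by nra.
    assert (Hd : 4 <= t ^ 2 * (t ^ 2 + 3)) by (generalize dependent (t ^ 2); intros; nra).
    destruct (Rle_or_lt 7 t) as [H7|H7].
    - apply Rplus_le_le_0_compat; [|lra]. apply Rmult_le_pos; [nra|].
      left. apply Rinv_0_lt_compat. lra.
    - assert (Hp : (S p < 3)%nat).
      { apply Nat.nle_gt. intros H. apply le_INR in H. replace (INR 3) with 3 in H by (simpl; lra).
        fold P in H. nra. }
      assert (Hq : (S q < 5)%nat).
      { apply Nat.nle_gt. intros H. apply le_INR in H. replace (INR 5) with 5 in H by (simpl; lra).
        unfold Q in Ht. nra. }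
      assert (Hw6 : (/ 5) ^ 6 <= w) by (apply pow_fifth_antitone; lia).
      simpl in Hw6.
      assert (-12 <= (12 * (t - 3) * t - 6 * (t ^ 2 + 3)) / (t ^ 2 * (t ^ 2 + 3))); [|lra].
      apply Rmult_le_reg_r with (t ^ 2 * (t ^ 2 + 3)); [lra|].
      unfold Rdiv. rewrite Rmult_assoc, Rinv_l by lra.
      nra. }
  assert (Hk : 4 / (9 * INR N ^ 2) >= / (16 * INR N ^ 2)).
  { pose proof (Rinv_0_lt_compat (INR N ^ 2) ltac:(lra)).
    unfold Rdiv. rewrite !Rinv_mult. lra. }
  replace ((t + 1 - 2 * P) / (9 * INR N ^ 2)) with (t / (9 * INR N ^ 2) + (1 - 2 * P) / (9 * INR N ^ 2)) by (field; lra).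
  replace ((t + 1 + 2 * P) / (9 * INR N ^ 2)) with (t / (9 * INR N ^ 2) + 2 / (9 * INR N ^ 2) - (1 - 2 * P) / (9 * INR N ^ 2)) by (field; lra).
  replace ((t + 1 - 2 * Q) / (9 * INR N ^ 2)) with (t / (9 * INR N ^ 2) + (1 - 2 * Q) / (9 * INR N ^ 2)) by (field; lra).
  replace ((t + 1 + 2 * Q) / (9 * INR N ^ 2)) with (t / (9 * INR N ^ 2) + 2 / (9 * INR N ^ 2) - (1 - 2 * Q) / (9 * INR N ^ 2)) by (field; lra).
  lra.
Qed.

Lemma pot_edge (N q : nat) : (1 <= N)%nat -> (1 <= q)%nat ->
  / (16 * INR N ^ 2) <=
  pot N 1 (S q) + pot N 0 q + pot N 0 (S (S q)) - 3 * pot N 0 (S q).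
Proof.
  intros HN Hq. pose proof (Nsqr_pos N HN) as HN2.
  assert (HN1 : 1 <= INR N) by (apply le_INR in HN; exact HN).
  set (Q := INR (S q) - 2). set (t := dist2 0 (S q)).
  assert (Ht : t = Q ^ 2 + 1) by (unfold t, dist2, Q; simpl INR; ring).
  pose proof (dist2_ge_1 0 (S q)) as Ht1. fold t in Ht1.
  pose proof (ln_inv_edge Q t Ht) as HL.
  assert (E1 : dist2 1 (S q) = t + 1) by (unfold t, dist2; simpl (INR 1); simpl (INR 0); ring).
  assert (E3 : dist2 0 q = t + 1 - 2 * Q)
    by (unfold t, dist2, Q; rewrite !S_INR; simpl (INR 0); ring).
  assert (E4 : dist2 0 (S (S q)) = t + 1 + 2 * Q)
    by (unfold t, dist2, Q; rewrite !S_INR; simpl (INR 0); ring).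
  unfold pot. rewrite E1, E3, E4. fold t.
  set (w := (/ 5) ^ (0 + S q)). pose proof (pow_fifth_pos (0 + S q)) as Hw. fold w in Hw.
  replace ((/ 5) ^ (0 + q)) with (5 * w) by (unfold w; cbn [Nat.add pow]; field).
  replace ((/ 5) ^ (1 + S q)) with (/ 5 * w) by (unfold w; cbn [Nat.add pow]; field).
  replace ((/ 5) ^ (0 + S (S q))) with (/ 5 * w) by (unfold w; cbn [Nat.add pow]; field).
  (* With three neighbours the exponential contributes (5 + 1/5 + 1/5 - 3) * 1000000 times [w]. Only
     q = 1 and q = 2 call on it. *)
  assert (Hcore : 0 <= (t ^ 2 - 3 * t - 5) / t ^ 3
    + 3 * (/ (t + 1) + 2 * (t + 1) / (t ^ 2 - 2 * t + 5) - 3 / t) + 2400000 * w).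
  { destruct (Nat.lt_ge_cases q 3) as [H3|H3].
    - assert (Hw3 : (/ 5) ^ 3 <= w) by (apply pow_fifth_antitone; lia). simpl in Hw3.
      assert (Hq12 : q = 1%nat \/ q = 2%nat) by lia.
      destruct Hq12 as [-> | ->].
      + replace t with 1 by (rewrite Ht; unfold Q; simpl; lra). lra.
      + replace t with 2 by (rewrite Ht; unfold Q; simpl; lra). lra.
    - apply le_INR in H3. replace (INR 3) with 3 in H3 by (simpl; lra).
      assert (HQ : 2 <= Q) by (unfold Q; rewrite S_INR; lra).
      assert (H5 : 5 <= t) by nra.
      assert (0 <= (t ^ 2 - 3 * t - 5) / t ^ 3).
      { apply Rmult_le_pos; [nra|]. left. apply Rinv_0_lt_compat, pow_lt. lra. }
      assert (0 <= / (t + 1) + 2 * (t + 1) / (t ^ 2 - 2 * t + 5) - 3 / t); [|lra].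
      replace (/ (t + 1) + 2 * (t + 1) / (t ^ 2 - 2 * t + 5) - 3 / t)
        with ((t * (t ^ 2 - 2 * t + 5) + 2 * (t + 1) ^ 2 * t
               - 3 * (t + 1) * (t ^ 2 - 2 * t + 5)) / ((t + 1) * (t ^ 2 - 2 * t + 5) * t))
        by (field; nra).
      apply Rmult_le_pos; [nra|].
      left. apply Rinv_0_lt_compat. repeat apply Rmult_lt_0_compat; nra. }
  assert (Hk : 3 / (9 * INR N ^ 2) >= / (16 * INR N ^ 2)).
  { pose proof (Rinv_0_lt_compat (INR N ^ 2) ltac:(lra)).
    unfold Rdiv. rewrite !Rinv_mult. lra. }
  replace ((t + 1) / (9 * INR N ^ 2)) with (t / (9 * INR N ^ 2) + / (9 * INR N ^ 2)) by (field; lra).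
  replace ((t + 1 - 2 * Q) / (9 * INR N ^ 2)) with (t / (9 * INR N ^ 2) + (1 - 2 * Q) / (9 * INR N ^ 2)) by (field; lra).
  replace ((t + 1 + 2 * Q) / (9 * INR N ^ 2)) with (t / (9 * INR N ^ 2) + 2 / (9 * INR N ^ 2) - (1 - 2 * Q) / (9 * INR N ^ 2)) by (field; lra).
  unfold Rdiv in *. lra.
Qed.

Lemma pot_diagonal (N p : nat) : (1 <= N)%nat -> (p + 2 <= 2 * N)%nat ->
  / (16 * INR N ^ 2) <=
  pot N p (S (S p)) + pot N (S p) (S (S (S p))) - 2 * pot N (S p) (S (S p)).
Proof.
  intros HN Hp. pose proof (Nsqr_pos N HN) as HN2.
  assert (HN1 : 1 <= INR N) by (apply le_INR in HN; exact HN).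
  apply le_INR in Hp. rewrite plus_INR, mult_INR in Hp. simpl (INR 2) in Hp.
  pose proof (pos_INR p) as Hp0.
  set (x := dist2 p (S (S p))). set (y := dist2 (S p) (S (S (S p)))).
  set (t := dist2 (S p) (S (S p))).
  assert (Ex : x = 2 * INR p ^ 2 + 1) by (unfold x, dist2; rewrite !S_INR; ring).
  assert (Ey : y = 2 * INR p ^ 2 + 4 * INR p + 3) by (unfold y, dist2; rewrite !S_INR; ring).
  assert (Et : t = 2 * INR p ^ 2 + 2 * INR p + 2) by (unfold t, dist2; rewrite !S_INR; ring).
  assert (HL : (2 * t - 3) / t ^ 2 <= - (ln x + ln y - 2 * ln t) + 3 * (/ x + / y - 2 * / t)).
  { pose proof (pow2_ge_0 (INR p)).
    apply ln_inv_diagonal; [lra|lra|lra|lra|]. rewrite Ex, Ey, Et. ring. }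
  unfold pot. fold x y t.
  set (w := (/ 5) ^ (S p + S (S p))).
  pose proof (pow_fifth_pos (S p + S (S p))) as Hw. fold w in Hw.
  replace ((/ 5) ^ (p + S (S p))) with (5 * w) by (unfold w; cbn [Nat.add pow]; field).
  replace ((/ 5) ^ (S p + S (S (S p)))) with (/ 5 * w)
    by (unfold w; rewrite !Nat.add_succ_r; cbn [Nat.add pow]; field).
  (* The linear term is harmonic along the diagonal, so here the order N^-2 comes from the
     logarithm, whose gain is at least 1/(2t) with t at most 8 N^2. *)
  assert (Hk : / (16 * INR N ^ 2) <= (2 * t - 3) / t ^ 2).
  { assert (2 <= t) by nra. assert (t <= 8 * INR N ^ 2) by nra.
    apply Rle_trans with (/ (2 * t)); [apply Rinv_le_contravar; lra|].
    apply Rmult_le_reg_r with (2 * t ^ 2); [nra|].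
    replace (/ (2 * t) * (2 * t ^ 2)) with t by (field; lra).
    replace ((2 * t - 3) / t ^ 2 * (2 * t ^ 2)) with (2 * (2 * t - 3)) by (field; lra).
    lra. }
  replace (y / (9 * INR N ^ 2)) with (2 * (t / (9 * INR N ^ 2)) - x / (9 * INR N ^ 2))
    by (rewrite Ex, Ey, Et; field; lra).
  lra.
Qed.

(** The adjacent pair (0, 1) has a single move, to (0, 2), along which the exponential drops by a
    constant. The repair of the neighbouring points is thus paid for here. *)
Lemma pot_corner (N : nat) : (1 <= N)%nat -> - 1000000 <= pot N 0 2 - pot N 0 1.
Proof.
  intros HN. pose proof (Nsqr_pos N HN) as HN2.
  assert (HN1 : 1 <= INR N) by (apply le_INR in HN; exact HN). unfold pot.
  replace (dist2 0 2) with 1 by (unfold dist2; simpl; ring).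
  replace (dist2 0 1) with 2 by (unfold dist2; simpl; ring).
  rewrite ln_1. assert (0 < ln 2) by (rewrite <- ln_1; apply ln_increasing; lra).
  assert (1 / (9 * INR N ^ 2) <= 1 / 9).
  { unfold Rdiv. apply Rmult_le_compat_l; [lra|]. apply Rinv_le_contravar; lra. }
  replace (2 / (9 * INR N ^ 2)) with (2 * (1 / (9 * INR N ^ 2))) by (field; lra).
  replace ((/ 5) ^ (0 + 2)) with (/ 25) by (simpl; lra).
  replace ((/ 5) ^ (0 + 1)) with (/ 5) by (simpl; lra).
  assert (0 < 1 / (9 * INR N ^ 2)) by (apply Rdiv_lt_0_compat; lra). lra.
Qed.

(** The decay in [b] makes the total change summable when a discrepancy steps off the end. The
    constant is 1 for the logarithm, 3 for the inverse and 1000000 for the exponential. *)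
Lemma pot_edge_gradient (N b : nat) : (1 <= N)%nat -> (2 <= b)%nat ->
  pot N 0 b - pot N 1 b <= 1000004 * / dist2 0 b.
Proof.
  intros HN Hb. pose proof (Nsqr_pos N HN) as HN2. unfold pot.
  pose proof (dist2_ge_1 0 b) as Ht.
  assert (E1 : dist2 1 b = dist2 0 b + 1) by (unfold dist2; simpl (INR 1); simpl (INR 0); ring).
  rewrite E1. set (t := dist2 0 b) in *.
  assert (Hl := ln_ratio_le (t + 1) t ltac:(lra) ltac:(lra)).
  replace ((t + 1 - t) / t) with (/ t) in Hl by (field; lra).
  assert (0 < / (t + 1)) by (apply Rinv_0_lt_compat; lra).
  assert (0 < / (9 * INR N ^ 2)) by (apply Rinv_0_lt_compat; lra).
  assert (Hw : (/ 5) ^ b <= / t).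
  { assert (Hg : t <= 5 ^ b).
    { assert (H5 : INR b ^ 2 + 1 <= 5 ^ b).
      { clear. induction b as [|b IH]; [simpl; lra|].
        rewrite S_INR. cbn [pow]. pose proof (pow2_ge_0 (2 * INR b - 1)). nra. }
      unfold t, dist2. simpl (INR 0). apply le_INR in Hb. simpl (INR 2) in Hb. nra. }
    rewrite pow_inv. apply Rinv_le_contravar; lra. }
  replace ((/ 5) ^ (1 + b)) with (/ 5 * (/ 5) ^ b) by (cbn [Nat.add pow]; ring).
  replace (0 + b)%nat with b by lia. pose proof (pow_fifth_pos b).
  unfold Rdiv. lra.
Qed.

(** One far pair measured from its two ends: the squared distances differ by a bounded factor, so
    the logarithms differ by a constant. *)
Lemma pot_far_gradient (N : nat) : (2 <= N)%nat ->
  pot N 0 (2 * N - 1) - pot N 1 (2 * N) <= 5000000.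
Proof.
  intros HN. pose proof (Nsqr_pos N ltac:(lia)) as HN2. unfold pot.
  pose proof (dist2_ge_1 0 (2 * N - 1)) as Ht. pose proof (dist2_ge_1 1 (2 * N)) as Ht'.
  assert (Hl := ln_ratio_le _ _ (Rlt_le_trans _ _ _ Rlt_0_1 Ht') (Rlt_le_trans _ _ _ Rlt_0_1 Ht)).
  set (t := dist2 0 (2 * N - 1)) in *. set (t' := dist2 1 (2 * N)) in *.
  apply le_INR in HN as HN'. simpl (INR 2) in HN'.
  assert (Et : t = (2 * INR N - 3) ^ 2 + 1).
  { unfold t, dist2. rewrite minus_INR, mult_INR by lia. simpl (INR 0). simpl (INR 1).
    simpl (INR 2). ring. }
  assert (Et' : t' = (2 * INR N - 2) ^ 2 + 2).
  { unfold t', dist2. rewrite mult_INR. simpl (INR 1). simpl (INR 2). ring. }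
  assert (Hr : (t' - t) / t <= 3).
  { apply Rmult_le_reg_r with t; [lra|]. unfold Rdiv. rewrite Rmult_assoc, Rinv_l by lra. nra. }
  assert (Hi : / t <= 1) by (rewrite <- Rinv_1; apply Rinv_le_contravar; lra).
  assert (0 < / t') by (apply Rinv_0_lt_compat; lra).
  assert (t / (9 * INR N ^ 2) <= t' / (9 * INR N ^ 2)).
  { apply Rmult_le_compat_r; [left; apply Rinv_0_lt_compat; lra|]. nra. }
  assert ((/ 5) ^ (0 + (2 * N - 1)) <= 1).
  { pose proof (pow_fifth_antitone 0 (0 + (2 * N - 1)) ltac:(lia)). simpl in *. lra. }
  pose proof (pow_fifth_pos (1 + 2 * N)). lra.
Qed.

(** The bound depends on one coordinate only, so it can be summed over the partner. The constant is
    1000000 + 3 + 1 plus 89, a crude bound for ln 90. *)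
Lemma pot_upper (N a b c : nat) : (1 <= N)%nat -> dist2 a b <= 9 * INR N ^ 2 ->
  c = a \/ c = b ->
  pot N a b <= 1000093 + 2 * (ln (INR (2 * N + 1)) - ln (INR (S c))).
Proof.
  intros HN Ht Hc. pose proof (Nsqr_pos N HN) as HN2. unfold pot.
  pose proof (dist2_ge_1 a b) as Ht1.
  assert (Hs : INR (S c) ^ 2 <= 10 * dist2 a b).
  { unfold dist2. rewrite S_INR.
    pose proof (pow2_ge_0 (INR a)). pose proof (pow2_ge_0 (INR b - 2)).
    destruct Hc as [-> | ->].
    - pose proof (pow2_ge_0 (3 * INR a - 1)). nra.
    - pose proof (pow2_ge_0 (3 * (INR b - 2) - 1)). nra. }
  assert (Hi : / dist2 a b <= 1) by (rewrite <- Rinv_1; apply Rinv_le_contravar; lra).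
  assert (Hq : dist2 a b / (9 * INR N ^ 2) <= 1).
  { apply Rmult_le_reg_r with (9 * INR N ^ 2); [lra|]. unfold Rdiv.
    rewrite Rmult_assoc, Rinv_l by lra. lra. }
  assert (Hw : (/ 5) ^ (a + b) <= 1).
  { pose proof (pow_fifth_antitone 0 (a + b) ltac:(lia)). simpl in *. lra. }
  assert (HS : 0 < INR (S c)) by (apply lt_0_INR; lia).
  assert (Hn : 0 < INR (2 * N + 1)) by (apply lt_0_INR; lia).
  apply le_INR in HN as HN1. simpl in HN1.
  assert (Hl1 : ln (9 * INR N ^ 2) <= ln (9 * INR (2 * N + 1) ^ 2)).
  { apply ln_le; [lra|]. rewrite plus_INR, mult_INR. simpl (INR 2). simpl (INR 1). nra. }
  assert (Hl2 : ln (INR (S c) ^ 2) <= ln (10 * dist2 a b)).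
  { apply ln_le; [apply pow_lt; easy|easy]. }
  assert (Hsq : forall x, 0 < x -> ln (x ^ 2) = 2 * ln x).
  { intros x Hx. replace (x ^ 2) with (x * x) by ring. rewrite ln_mult by easy. ring. }
  rewrite (ln_mult 9 (INR (2 * N + 1) ^ 2)), Hsq in Hl1 by (try apply pow_lt; lra).
  rewrite ln_mult, Hsq in Hl2 by lra.
  pose proof (ln_le_sub_1 (9 * 10) ltac:(lra)) as H90. rewrite ln_mult in H90 by lra.
  lra.
Qed.

(** This is n ln n - ln n! <= n, the elementary half of Stirling's formula; it keeps the sum of the
    potentials at order N. *)
Lemma sum_ln_le (n : nat) :
  sumL (seq 0 n) (fun c => ln (INR n) - ln (INR (S c))) <= INR n.
Proof.
  induction n as [|n IH]; [simpl; lra|].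
  rewrite sumL_seq_S.
  rewrite (sumL_ext _ _ (fun c => (ln (INR n) - ln (INR (S c))) + (ln (INR (S n)) - ln (INR n))))
    by (intros; ring).
  rewrite sumL_plus, sumL_const, length_seq.
  assert (INR n * (ln (INR (S n)) - ln (INR n)) <= 1).
  { destruct n as [|n]; [simpl; lra|].
    assert (0 < INR (S n)) by (apply lt_0_INR; lia).
    assert (0 < INR (S (S n))) by (apply lt_0_INR; lia).
    pose proof (ln_ratio_le (INR (S (S n))) (INR (S n)) ltac:(easy) ltac:(easy)) as Hr.
    rewrite (S_INR (S n)) in Hr at 2.
    replace ((INR (S n) + 1 - INR (S n)) / INR (S n)) with (/ INR (S n)) in Hr by (field; lra).
    apply Rmult_le_compat_l with (r := INR (S n)) in Hr; [|lra].
    rewrite Rinv_r in Hr by lra. lra. }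
  pose proof (S_INR n) as HSn. lra.
Qed.

Lemma sum_inv_dist2_le (m : nat) : (1 <= m)%nat ->
  sumL (seq 0 m) (fun q => / dist2 0 (q + 2)) <= 4 - 2 / INR m.
Proof.
  intros Hm. induction m as [|m IH]; [lia|].
  assert (E : forall q, dist2 0 (q + 2) = INR q ^ 2 + 1).
  { intros q. unfold dist2. rewrite plus_INR. simpl (INR 2). simpl (INR 0). ring. }
  destruct m as [|m].
  - change (/ dist2 0 2 + 0 <= 4 - 2 / INR 1). rewrite (E 0%nat : dist2 0 2 = _). simpl. lra.
  - rewrite sumL_seq_S. specialize (IH ltac:(lia)). rewrite E.
    rewrite (S_INR (S m)).
    assert (H1 : 1 <= INR (S m)) by (apply (le_INR 1); lia).
    set (x := INR (S m)) in *.
    assert (/ (x ^ 2 + 1) <= 2 / x - 2 / (x + 1)); [|lra].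
    replace (2 / x - 2 / (x + 1)) with (/ ((x ^ 2 + x) / 2)) by (field; nra).
    apply Rinv_le_contravar; nra.
Qed.

(** * Two stirred particles *)

Definition tau (i x : nat) : nat :=
  if (x =? i)%nat then S i else if (x =? S i)%nat then i else x.

Definition spot (N p q : nat) : R := pot N (Nat.min p q) (Nat.max p q).

(** The generator of two particles moved by the exchanges. Since [spot] is symmetric, the exchange
    of the two particles with each other contributes 0. *)
Definition stir (N p q : nat) : R :=
  / 2 * sumL (seq 0 (2 * N)) (fun i => spot N (tau i p) (tau i q) - spot N p q).

Lemma spot_comm (N p q : nat) : spot N p q = spot N q p.
Proof. unfold spot. now rewrite Nat.min_comm, Nat.max_comm. Qed.

Lemma spot_lt (N p q : nat) : (p < q)%nat -> spot N p q = pot N p q.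
Proof. intros H. unfold spot. now rewrite Nat.min_l, Nat.max_r by lia. Qed.

Lemma spot_gt (N p q : nat) : (q < p)%nat -> spot N p q = pot N q p.
Proof. intros H. rewrite spot_comm. now apply spot_lt. Qed.

Lemma stir_comm (N p q : nat) : stir N p q = stir N q p.
Proof.
  unfold stir. f_equal. apply sumL_ext. intros i _.
  now rewrite (spot_comm N p q), (spot_comm N (tau i p)).
Qed.

Lemma dist2_le (N a b : nat) : (2 <= N)%nat -> (a < b <= 2 * N + 1)%nat ->
  dist2 a b <= 9 * INR N ^ 2.
Proof.
  intros HN Hab. unfold dist2.
  assert (Ha : (a <= 2 * N)%nat) by lia. assert (Hb : (b <= 2 * N + 1)%nat) by lia.
  apply le_INR in Ha, Hb, HN. rewrite mult_INR in Ha. rewrite plus_INR, mult_INR in Hb.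
  simpl (INR 2) in *. simpl (INR 1) in *. pose proof (pos_INR a). pose proof (pos_INR b).
  assert (Ha2 : INR a ^ 2 <= (2 * INR N) ^ 2) by (apply pow_incr; lra).
  destruct (Rlt_le_dec (INR b) 2) as [H2|H2].
  - assert ((INR b - 2) ^ 2 <= 4) by nra. nra.
  - assert ((INR b - 2) ^ 2 <= (2 * INR N - 1) ^ 2) by (apply pow_incr; lra). nra.
Qed.

Lemma pot_far_step (N a b : nat) : (2 <= N)%nat -> (a < b <= 2 * N)%nat -> (2 <= b)%nat ->
  pot N a (S b) <= pot N a b.
Proof.
  intros HN Hab Hb. apply pot_antitone; [lia| |apply dist2_le; lia|lia].
  unfold dist2. rewrite S_INR. apply le_INR in Hb. simpl (INR 2) in Hb. nra.
Qed.

Lemma stir_lower (N p q : nat) : (2 <= N)%nat -> (p < q <= 2 * N)%nat ->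
  (2 <= q)%nat -> / (32 * INR N ^ 2) <= stir N p q.
Proof.
  intros HN Hpq Hq. unfold stir.
  (* At q = 2N the move to q + 1 does not exist. Its omission only helps, because it would lower the
     potential. *)
  pose proof (pot_far_step N p q HN Hpq Hq) as Hfar.
  assert (HH : / (16 * INR N ^ 2) <=
    sumL (seq 0 (2 * N)) (fun i => spot N (tau i p) (tau i q) - spot N p q)).
  2:{ assert (1 <= INR N) by (apply (le_INR 1); lia).
      replace (/ (32 * INR N ^ 2)) with (/ 2 * / (16 * INR N ^ 2)) by (field; lra). lra. }
  destruct q as [|q]; [lia|].
  remember (pot N p (S q)) as u eqn:Hu.
  destruct p as [|p].
  - rewrite (sumL_ext _ _ (fun i =>
       (if (i =? 0)%nat then pot N 1 (S q) - u else 0)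
       + ((if (i =? q)%nat then pot N 0 q - u else 0)
          + (if (i =? S q)%nat then pot N 0 (S (S q)) - u else 0)))).
    + rewrite !sumL_plus, !sumL_single.
      pose proof (pot_edge N q ltac:(lia) ltac:(lia)) as HE. rewrite <- Hu in HE.
      destruct (Nat.ltb_spec 0 (2 * N)); [|lia]. destruct (Nat.ltb_spec q (2 * N)); [|lia].
      destruct (Nat.ltb_spec (S q) (2 * N)); lra.
    + intros i _. unfold tau. rewrite (spot_lt N 0 (S q)) by lia. rewrite <- Hu.
      repeat match goal with |- context [(?x =? ?y)%nat] => destruct (Nat.eqb_spec x y) end; try lia; subst; try lia;
        repeat first [rewrite spot_lt by lia|rewrite spot_gt by lia]; try lra.
  - destruct (Nat.eq_dec q (S p)) as [-> |Hne].
    + rewrite (sumL_ext _ _ (fun i =>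
         (if (i =? p)%nat then pot N p (S (S p)) - u else 0)
         + (if (i =? S (S p))%nat then pot N (S p) (S (S (S p))) - u else 0))).
      * rewrite !sumL_plus, !sumL_single.
        pose proof (pot_diagonal N p ltac:(lia) ltac:(lia)) as HE. rewrite <- Hu in HE.
        destruct (Nat.ltb_spec p (2 * N)); [|lia].
        destruct (Nat.ltb_spec (S (S p)) (2 * N)); lra.
      * intros i _. unfold tau. rewrite (spot_lt N (S p)) by lia. rewrite <- Hu.
        repeat match goal with |- context [(?x =? ?y)%nat] => destruct (Nat.eqb_spec x y) end; try lia; subst; try lia;
          repeat first [rewrite spot_lt by lia|rewrite spot_gt by lia]; try lra.
    + rewrite (sumL_ext _ _ (fun i =>
         (if (i =? p)%nat then pot N p (S q) - u else 0)
         + ((if (i =? S p)%nat then pot N (S (S p)) (S q) - u else 0)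
            + ((if (i =? q)%nat then pot N (S p) q - u else 0)
               + (if (i =? S q)%nat then pot N (S p) (S (S q)) - u else 0))))).
      * rewrite !sumL_plus, !sumL_single.
        pose proof (pot_interior N p q ltac:(lia) ltac:(lia)) as HE. rewrite <- Hu in HE.
        destruct (Nat.ltb_spec p (2 * N)); [|lia]. destruct (Nat.ltb_spec (S p) (2 * N)); [|lia].
        destruct (Nat.ltb_spec q (2 * N)); [|lia].
        destruct (Nat.ltb_spec (S q) (2 * N)); lra.
      * intros i _. unfold tau. rewrite (spot_lt N (S p)) by lia. rewrite <- Hu.
        repeat match goal with |- context [(?x =? ?y)%nat] => destruct (Nat.eqb_spec x y) end; try lia; subst; try lia;
          repeat first [rewrite spot_lt by lia|rewrite spot_gt by lia]; try lra.
Qed.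

Lemma stir_corner (N : nat) : (2 <= N)%nat -> - 1000000 <= stir N 0 1.
Proof.
  intros HN. unfold stir.
  rewrite (sumL_ext _ _ (fun i => if (i =? 1)%nat then pot N 0 2 - pot N 0 1 else 0)).
  - rewrite sumL_single. destruct (Nat.ltb_spec 1 (2 * N)); [|lia].
    pose proof (pot_corner N ltac:(lia)). lra.
  - intros i _. unfold tau. rewrite (spot_lt N 0 1) by lia.
    repeat match goal with |- context [(?x =? ?y)%nat] => destruct (Nat.eqb_spec x y) end; try lia; subst; try lia;
      repeat first [rewrite spot_lt by lia|rewrite spot_gt by lia]; try lra.
Qed.

(** * The Lyapunov function *)

(* The value of [e] at [x], the site of the discrepancy, is ignored. *)
Definition env_pot (N x : nat) (e : nat -> bool) (y : nat) : R :=
  if (y =? x)%nat then 0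
  else if e y then spot N (2 * N - x) (2 * N - y) else spot N x y.

Definition total_pot (N x : nat) (e : nat -> bool) : R :=
  sumL (seq 0 (2 * N + 1)) (env_pot N x e).

Definition parab (N x : nat) : R := ((INR x - INR N) / INR N) ^ 2.

Definition lyap (N : nat) (B delta : R) (x : nat) (e : nat -> bool) : R :=
  1 + B * parab N x - delta * total_pot N x e.

Lemma spot_nonneg (N p q : nat) : (2 <= N)%nat -> p <> q -> (p <= 2 * N)%nat ->
  (q <= 2 * N)%nat -> 0 <= spot N p q.
Proof.
  intros HN Hpq Hp Hq. apply pot_nonneg; [lia|]. apply dist2_le; lia.
Qed.

Lemma spot_upper (N p q : nat) : (2 <= N)%nat -> p <> q -> (p <= 2 * N)%nat ->
  (q <= 2 * N)%nat ->
  spot N p q <= 1000093 + 2 * (ln (INR (2 * N + 1)) - ln (INR (S q))).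
Proof.
  intros HN Hpq Hp Hq. apply pot_upper; [lia|apply dist2_le; lia|lia].
Qed.

Lemma total_pot_nonneg (N x : nat) (e : nat -> bool) : (2 <= N)%nat -> (x <= 2 * N)%nat ->
  0 <= total_pot N x e.
Proof.
  intros HN Hx. unfold total_pot.
  rewrite <- (Rmult_0_r (INR (length (seq 0 (2 * N + 1))))), <- sumL_const.
  apply sumL_le. intros y Hy. apply in_seq in Hy. unfold env_pot.
  destruct (Nat.eqb_spec y x); [lra|]. destruct (e y); apply spot_nonneg; lia.
Qed.

Lemma total_pot_upper (N x : nat) (e : nat -> bool) : (2 <= N)%nat -> (x <= 2 * N)%nat ->
  total_pot N x e <= 2000190 * INR (2 * N + 1).
Proof.
  intros HN Hx. unfold total_pot.
  set (f := fun c => 1000093 + 2 * (ln (INR (2 * N + 1)) - ln (INR (S c)))).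
  assert (Hf : forall c, (c <= 2 * N)%nat -> 0 <= f c).
  { intros c Hc. unfold f.
    assert (ln (INR (S c)) <= ln (INR (2 * N + 1)))
      by (apply ln_le; [apply lt_0_INR; lia|apply le_INR; lia]).
    lra. }
  (* From whichever end the partner is measured, one of these two nonnegative terms bounds it; a
     reflection makes both sums equal. *)
  apply Rle_trans with (sumL (seq 0 (2 * N + 1)) (fun y => f (2 * N - y)%nat + f y)).
  - apply sumL_le. intros y Hy. apply in_seq in Hy.
    assert (H1 := Hf y ltac:(lia)). assert (H2 := Hf (2 * N - y)%nat ltac:(lia)).
    unfold env_pot. destruct (Nat.eqb_spec y x); [lra|].
    destruct (e y).
    + pose proof (spot_upper N (2 * N - x) (2 * N - y) HN ltac:(lia) ltac:(lia) ltac:(lia)).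
      unfold f in *. lra.
    + pose proof (spot_upper N x y HN ltac:(lia) ltac:(lia) ltac:(lia)). unfold f in *. lra.
  - rewrite sumL_plus, (sumL_involution (2 * N + 1) (fun y => 2 * N - y)%nat) by (intros; lia).
    unfold f. rewrite sumL_plus, sumL_const, sumL_scal, length_seq.
    pose proof (sum_ln_le (2 * N + 1)). lra.
Qed.

Lemma total_pot_ext (N x : nat) (e e' : nat -> bool) :
  (forall y, (y <= 2 * N)%nat -> y <> x -> e y = e' y) -> total_pot N x e = total_pot N x e'.
Proof.
  intros H. apply sumL_ext. intros y Hy. apply in_seq in Hy. unfold env_pot.
  destruct (Nat.eqb_spec y x); [easy|]. rewrite H by lia. easy.
Qed.

Lemma tau_involutive (i x : nat) : tau i (tau i x) = x.
Proof.
  unfold tau. destruct (Nat.eqb_spec x i), (Nat.eqb_spec x (S i));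
  repeat match goal with |- context [(?x =? ?y)%nat] => destruct (Nat.eqb_spec x y) end; lia.
Qed.

Lemma tau_le (N i x : nat) : (i < 2 * N)%nat -> (x <= 2 * N)%nat -> (tau i x <= 2 * N)%nat.
Proof.
  intros Hi Hx. unfold tau.
  repeat match goal with |- context [(?x =? ?y)%nat] => destruct (Nat.eqb_spec x y) end; lia.
Qed.

Lemma tau_reflect (N i x : nat) : (i < 2 * N)%nat -> (x <= 2 * N)%nat ->
  (2 * N - tau i x)%nat = tau (2 * N - 1 - i) (2 * N - x).
Proof.
  intros Hi Hx. unfold tau.
  repeat match goal with |- context [(?x =? ?y)%nat] => destruct (Nat.eqb_spec x y) end; lia.
Qed.

(** Reindexing by [tau i] follows each partner as it moves: its type stays [e y] and only positions
    change. Hence stirring acts on each pair separately. *)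
Lemma total_pot_tau (N i x : nat) (e : nat -> bool) : (i < 2 * N)%nat -> (x <= 2 * N)%nat ->
  total_pot N (tau i x) (fun y => e (tau i y)) =
  sumL (seq 0 (2 * N + 1)) (fun y => if (y =? x)%nat then 0 else
    if e y then spot N (2 * N - tau i x) (2 * N - tau i y) else spot N (tau i x) (tau i y)).
Proof.
  intros Hi Hx. unfold total_pot.
  rewrite <- (sumL_involution (2 * N + 1) (tau i)).
  - apply sumL_ext. intros y Hy. unfold env_pot. rewrite tau_involutive.
    replace (tau i y =? tau i x)%nat with (y =? x)%nat; [easy|].
    destruct (Nat.eqb_spec y x) as [->|Hne]; [now rewrite Nat.eqb_refl|].
    symmetry. apply Nat.eqb_neq. intros E. apply Hne.
    now rewrite <- (tau_involutive i y), E, tau_involutive.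
  - intros y Hy. pose proof (tau_le N i y Hi ltac:(lia)). lia.
  - intros y _. apply tau_involutive.
Qed.

Definition env_stir (N x : nat) (e : nat -> bool) (y : nat) : R :=
  if (y =? x)%nat then 0
  else if e y then stir N (2 * N - x) (2 * N - y) else stir N x y.

Lemma total_pot_stir (N x : nat) (e : nat -> bool) : (1 <= N)%nat -> (x <= 2 * N)%nat ->
  / 2 * sumL (seq 0 (2 * N))
    (fun i => total_pot N (tau i x) (fun y => e (tau i y)) - total_pot N x e)
  = sumL (seq 0 (2 * N + 1)) (env_stir N x e).
Proof.
  intros HN Hx.
  rewrite (sumL_ext (seq 0 (2 * N)) _ (fun i => sumL (seq 0 (2 * N + 1)) (fun y =>
    if (y =? x)%nat then 0 else
    if e y then spot N (2 * N - tau i x) (2 * N - tau i y) - spot N (2 * N - x) (2 * N - y)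
    else spot N (tau i x) (tau i y) - spot N x y))).
  - rewrite sumL_exchange, <- sumL_scal. apply sumL_ext. intros y Hy. apply in_seq in Hy.
    unfold env_stir, stir. destruct (y =? x)%nat; [rewrite sumL_const; ring|].
    destruct (e y); [|easy]. f_equal.
    (* Measured from the right end, the bond at i becomes the bond at 2N - 1 - i. *)
    rewrite <- (sumL_involution (2 * N) (fun i => 2 * N - 1 - i)%nat
      (fun i => spot N (tau i (2 * N - x)) (tau i (2 * N - y)) - _)) by (intros; lia).
    apply sumL_ext. intros i Hi. apply in_seq in Hi. now rewrite !tau_reflect by lia.
  - intros i Hi. apply in_seq in Hi. rewrite total_pot_tau by lia.
    unfold total_pot. rewrite <- sumL_minus. apply sumL_ext. intros y _. unfold env_pot.
    destruct (y =? x)%nat; [ring|]. now destruct (e y).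
Qed.

(** * Death at the reservoir sites and the drift of the potential sum *)

Definition reflect_env (N : nat) (e : nat -> bool) (y : nat) : bool := negb (e (2 * N - y)%nat).

(** With the other reservoir site occupied, injection fills the site of the discrepancy in the copy
    where it is empty and leaves the other copy, already full there, unchanged. *)
Definition dies_right (N x : nat) (e : nat -> bool) : bool :=
  ((x =? 2 * N)%nat && e (2 * N - 1)%nat) || ((x =? 2 * N - 1)%nat && e (2 * N)%nat).

Definition dies_left (N x : nat) (e : nat -> bool) : bool :=
  dies_right N (2 * N - x) (reflect_env N e).

Lemma stir_lower_pair (N p q : nat) : (2 <= N)%nat -> p <> q ->
  (p <= 2 * N)%nat -> (q <= 2 * N)%nat -> (2 <= p + q)%nat ->
  / (32 * INR N ^ 2) <= stir N p q.
Proof.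
  intros HN Hpq Hp Hq Hc. destruct (Nat.lt_ge_cases p q).
  - apply stir_lower; lia.
  - rewrite stir_comm. apply stir_lower; lia.
Qed.

Lemma stir_corner_pair (N p q : nat) : (2 <= N)%nat -> (p + q = 1)%nat ->
  - 1000000 <= stir N p q.
Proof.
  intros HN H. assert (E : ((p = 0 /\ q = 1) \/ (p = 1 /\ q = 0))%nat) by lia.
  destruct E as [[-> ->]|[-> ->]]; [|rewrite stir_comm]; now apply stir_corner.
Qed.

(** Two sites at total distance 1 from an end are its reservoir sites. On the right such a pair
    counts as a corner only if the partner is occupied, on the left only if it is empty: exactly
    when the discrepancy dies. *)
Lemma env_stir_lower (N x : nat) (e : nat -> bool) : (2 <= N)%nat -> (x <= 2 * N)%nat ->
  / (16 * INR N) - 1000001 * ((if dies_right N x e then 1 else 0)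
                              + (if dies_left N x e then 1 else 0))
  <= sumL (seq 0 (2 * N + 1)) (env_stir N x e).
Proof.
  intros HN Hx. assert (HN1 : 2 <= INR N) by (apply (le_INR 2); lia).
  set (k := / (32 * INR N ^ 2)).
  assert (Hk : 0 < k <= 1).
  { split; [apply Rinv_0_lt_compat; nra|].
    rewrite <- Rinv_1. apply Rinv_le_contravar; nra. }
  set (JR := if dies_right N x e then 1 else 0). set (JL := if dies_left N x e then 1 else 0).
  assert (HJR : 0 <= JR) by (unfold JR; destruct dies_right; lra).
  assert (HJL : 0 <= JL) by (unfold JL; destruct dies_left; lra).
  (* [4 * N - 1 - x] and [1 - x] are the corner partners of x. The first is out of range for x < 2N
     - 1; the second is truncated to 0 for x >= 2, where [JL] is 0. The constant 1000001 also
     cancels the [k] added for that partner. *)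
  apply Rle_trans with (sumL (seq 0 (2 * N + 1)) (fun y =>
    k + ((if (y =? x)%nat then - k else 0)
         + ((if (y =? 4 * N - 1 - x)%nat then - (1000001 * JR) else 0)
            + (if (y =? 1 - x)%nat then - (1000001 * JL) else 0))))).
  - rewrite !sumL_plus, !sumL_single, sumL_const, length_seq.
    rewrite plus_INR, mult_INR. simpl (INR 2). simpl (INR 1).
    replace (/ (16 * INR N)) with (2 * INR N * k) by (unfold k; field; lra).
    destruct (Nat.ltb_spec x (2 * N + 1)); [|lia].
    destruct (Nat.ltb_spec (4 * N - 1 - x) (2 * N + 1)),
      (Nat.ltb_spec (1 - x) (2 * N + 1)); lra.
  - apply sumL_le. intros y Hy. apply in_seq in Hy. unfold env_stir.
    destruct (Nat.eqb_spec y x) as [->|Hyx].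
    { destruct (x =? 4 * N - 1 - x)%nat, (x =? 1 - x)%nat; lra. }
    assert (Hgen : forall s, k <= s \/ (- 1000000 <= s /\
      ((y = (4 * N - 1 - x)%nat /\ JR = 1) \/ (y = (1 - x)%nat /\ JL = 1))) ->
      k + (0 + ((if (y =? 4 * N - 1 - x)%nat then - (1000001 * JR) else 0)
            + (if (y =? 1 - x)%nat then - (1000001 * JL) else 0))) <= s).
    { intros s Hs.
      destruct (Nat.eqb_spec y (4 * N - 1 - x)), (Nat.eqb_spec y (1 - x));
        destruct Hs as [Hs|[Hs [[? ?]|[? ?]]]]; try contradiction; lra. }
    destruct (e y) eqn:Ey; apply Hgen.
    + destruct (Nat.lt_ge_cases (2 * N - x + (2 * N - y)) 2).
      * right. split; [apply stir_corner_pair; lia|]. left. split; [lia|].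
        unfold JR, dies_right.
        assert (E : ((x = 2 * N /\ y = 2 * N - 1) \/ (x = 2 * N - 1 /\ y = 2 * N))%nat) by lia.
        destruct E as [[-> Hy'] | [-> Hy']]; rewrite Hy' in Ey; rewrite Ey, Nat.eqb_refl; simpl;
          [easy|now rewrite orb_true_r].
      * left. apply stir_lower_pair; lia.
    + destruct (Nat.lt_ge_cases (x + y) 2).
      * right. split; [apply stir_corner_pair; lia|]. right. split; [lia|].
        unfold JL, dies_left, dies_right, reflect_env.
        assert (E : ((x = 0 /\ y = 1) \/ (x = 1 /\ y = 0))%nat) by lia.
        replace (2 * N - (2 * N - 1))%nat with 1%nat by lia. rewrite Nat.sub_diag.
        destruct E as [[-> ->] | [-> ->]]; rewrite Ey.
        -- now rewrite Nat.sub_0_r, Nat.eqb_refl.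
        -- rewrite Nat.eqb_refl. simpl. now rewrite orb_true_r.
      * left. apply stir_lower_pair; lia.
Qed.

(** Inside, the second difference costs N^-2; at an end only the inward neighbour is left, and the
    first difference gains order 1/N. *)
Lemma parab_tau (N x : nat) : (2 <= N)%nat -> (x <= 2 * N)%nat ->
  / 2 * sumL (seq 0 (2 * N)) (fun i => parab N (tau i x) - parab N x) <=
  if ((x =? 0) || (x =? 2 * N))%nat then - / (2 * INR N) else / INR N ^ 2.
Proof.
  intros HN Hx. assert (HN1 : 2 <= INR N) by (apply (le_INR 2); lia).
  rewrite (sumL_ext _ _ (fun i => (if (i =? x)%nat then parab N (S x) - parab N x else 0)
    + (if (i =? x - 1)%nat then (if (x =? 0)%nat then 0 else parab N (x - 1) - parab N x) else 0))).
  - rewrite sumL_plus, !sumL_single.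
    assert (HS : forall z, parab N (S z) - parab N z = (2 * (INR z - INR N) + 1) * / INR N ^ 2).
    { intros z. unfold parab. rewrite S_INR. field. lra. }
    assert (Hi : 0 < / INR N ^ 2) by (apply Rinv_0_lt_compat; nra).
    assert (Hi1 : / (2 * INR N) = / 2 * INR N * / INR N ^ 2) by (field; lra).
    destruct x as [|x].
    + simpl ((0 =? 0)%nat || _). rewrite HS. simpl (INR 0).
      destruct (Nat.ltb_spec 0 (2 * N)); [|lia]. destruct (Nat.ltb_spec (0 - 1) (2 * N)); [|lia].
      simpl (0 =? 0)%nat. cbv iota. rewrite Hi1. nra.
    + replace (S x - 1)%nat with x by lia.
      replace (parab N x - parab N (S x)) with (- (parab N (S x) - parab N x)) by ring.
      rewrite !HS. change (S x =? 0)%nat with false. cbn [orb].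
      destruct (Nat.ltb_spec x (2 * N)); [|lia].
      destruct (Nat.eqb_spec (S x) (2 * N)) as [E|E].
      * destruct (Nat.ltb_spec (S x) (2 * N)); [lia|].
        assert (EI : INR x = 2 * INR N - 1).
        { apply (f_equal INR) in E. rewrite S_INR, mult_INR in E. simpl (INR 2) in E. lra. }
        rewrite EI, Hi1. nra.
      * destruct (Nat.ltb_spec (S x) (2 * N)); [|lia]. rewrite S_INR. lra.
  - intros i Hi. apply in_seq in Hi. unfold tau.
    repeat match goal with |- context [(?x =? ?y)%nat] => destruct (Nat.eqb_spec x y) end;
      try lia; subst; try lia; try lra.
    replace (S i - 1)%nat with i by lia. lra.
Qed.

Definition env (eta : list bool) (y : nat) : bool := nth y eta false.

Definition is_end (N x : nat) : bool := ((x =? 0) || (x =? 2 * N))%nat.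

Definition end_cost (N x : nat) : R := if is_end N x then 5000000 else 0.

Lemma end_cost_nonneg (N x : nat) : 0 <= end_cost N x.
Proof. unfold end_cost. destruct is_end; lra. Qed.

(** Only the partner [s] changes the end from which it is measured, normally to a pair at smaller
    distance, which raises the potential. The exception is x = 0 with s = 2N - 1. *)
Lemma total_pot_add_right (N x s : nat) (e e' : nat -> bool) : (2 <= N)%nat ->
  (x < 2 * N)%nat -> (s = 2 * N \/ (s = 2 * N - 1 /\ x < 2 * N - 1))%nat ->
  e s = false -> e' s = true -> (forall y, (y <= 2 * N)%nat -> y <> s -> e' y = e y) ->
  total_pot N x e - end_cost N x <= total_pot N x e'.
Proof.
  intros HN Hx Hs Hes Hes' He.
  assert (E : total_pot N x e' - total_pot N x e
              = spot N (2 * N - x) (2 * N - s) - spot N x s).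
  { unfold total_pot. rewrite <- sumL_minus.
    rewrite (sumL_ext _ _ (fun y => if (y =? s)%nat
      then spot N (2 * N - x) (2 * N - s) - spot N x s else 0)).
    - rewrite sumL_single. destruct (Nat.ltb_spec s (2 * N + 1)); [easy|lia].
    - intros y Hy. apply in_seq in Hy. unfold env_pot.
      destruct (Nat.eqb_spec y s) as [->|Hys].
      + destruct (Nat.eqb_spec s x); [lia|]. now rewrite Hes, Hes'.
      + rewrite He by lia. ring. }
  assert (spot N x s - end_cost N x <= spot N (2 * N - x) (2 * N - s)); [|lra].
  rewrite (spot_lt N x s), (spot_gt N (2 * N - x)) by lia.
  destruct Hs as [-> | [-> Hx']].
  - pose proof (end_cost_nonneg N x). rewrite Nat.sub_diag.
    assert (pot N x (2 * N) <= pot N 0 (2 * N - x)); [|lra].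
    apply pot_antitone; [lia| |apply dist2_le; lia|lia].
    unfold dist2. rewrite minus_INR, mult_INR by lia. simpl (INR 2). simpl (INR 0).
    pose proof (pos_INR x). assert (2 <= INR N) by (apply (le_INR 2); lia).
    assert (Hxx : (x <= 2 * N)%nat) by lia. apply le_INR in Hxx.
    rewrite mult_INR in Hxx. simpl (INR 2) in Hxx.
    nra.
  - replace (2 * N - (2 * N - 1))%nat with 1%nat by lia.
    destruct x as [|x].
    + unfold end_cost, is_end. simpl ((0 =? 0)%nat || _). cbv iota. rewrite Nat.sub_0_r.
      pose proof (pot_far_gradient N HN). lra.
    + pose proof (end_cost_nonneg N (S x)).
      assert (pot N (S x) (2 * N - 1) <= pot N 1 (2 * N - S x)); [|lra].
      apply pot_antitone; [lia| |apply dist2_le; lia|lia].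
      unfold dist2. rewrite !minus_INR, mult_INR by lia. simpl (INR 2). simpl (INR 1).
      assert (2 <= INR N) by (apply (le_INR 2); lia).
      assert (Hxx : (S x + 1 <= 2 * N)%nat) by lia. apply le_INR in Hxx.
      rewrite plus_INR, mult_INR in Hxx. simpl (INR 2) in Hxx. simpl (INR 1) in Hxx.
      assert (1 <= INR (S x)) by (apply (le_INR 1); lia).
      assert ((2 * INR N - INR (S x) - 2) ^ 2 <= (2 * INR N - 1 - 2) ^ 2) by nra.
      nra.
Qed.

(** When the discrepancy steps from 2N to 2N - 1, occupied partners are seen from one step off the
    edge, a summable loss; empty ones only gain; the adjacent partner passes from a farthest pair to
    the corner pair. *)
Lemma total_pot_move_right (N : nat) (e e' : nat -> bool) : (2 <= N)%nat ->
  e (2 * N - 1)%nat = false -> e' (2 * N)%nat = true ->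
  (forall y, (y < 2 * N - 1)%nat -> e' y = e y) ->
  total_pot N (2 * N) e - 5000000 <= total_pot N (2 * N - 1) e'.
Proof.
  intros HN He He' Hext. unfold total_pot.
  replace (2 * N + 1)%nat with ((2 * N - 1) + 2)%nat by lia.
  rewrite seq_app, Nat.add_0_l.
  rewrite !sumL_app.
  replace (seq (2 * N - 1) 2) with [(2 * N - 1)%nat; (2 * N)%nat]
    by (simpl seq; repeat f_equal; lia).
  cbn [sumL fold_right].
  unfold env_pot at 2 3 5 6. rewrite !Nat.eqb_refl.
  destruct (Nat.eqb_spec (2 * N - 1) (2 * N)); [lia|].
  destruct (Nat.eqb_spec (2 * N) (2 * N - 1)); [lia|].
  rewrite He, He', Nat.sub_diag.
  replace (2 * N - (2 * N - 1))%nat with 1%nat by lia.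
  rewrite (spot_gt N (2 * N)), (spot_gt N 1) by lia.
  assert (Hc : pot N (2 * N - 1) (2 * N) <= pot N 0 1).
  { apply pot_antitone; [lia| |apply dist2_le; lia|lia].
    unfold dist2. rewrite minus_INR, mult_INR by lia. simpl (INR 2). simpl (INR 1). simpl (INR 0).
    assert (2 <= INR N) by (apply (le_INR 2); lia). nra. }
  assert (Hsum : sumL (seq 0 (2 * N - 1)) (env_pot N (2 * N) e)
    <= sumL (seq 0 (2 * N - 1)) (fun y => env_pot N (2 * N - 1) e' y
         + 1000004 * / dist2 0 ((2 * N - 2 - y) + 2))).
  { apply sumL_le. intros y Hy. apply in_seq in Hy. unfold env_pot.
    destruct (Nat.eqb_spec y (2 * N)); [lia|]. destruct (Nat.eqb_spec y (2 * N - 1)); [lia|].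
    rewrite Hext by lia. replace (2 * N - 2 - y + 2)%nat with (2 * N - y)%nat by lia.
    assert (0 < / dist2 0 (2 * N - y)).
    { apply Rinv_0_lt_compat. pose proof (dist2_ge_1 0 (2 * N - y)). lra. }
    destruct (e y).
    - rewrite Nat.sub_diag. replace (2 * N - (2 * N - 1))%nat with 1%nat by lia.
      rewrite !spot_lt by lia.
      pose proof (pot_edge_gradient N (2 * N - y) ltac:(lia) ltac:(lia)). lra.
    - rewrite !spot_gt by lia.
      assert (pot N y (2 * N) <= pot N y (2 * N - 1)); [|lra].
      replace (2 * N)%nat with (S (2 * N - 1)) at 1 by lia. apply pot_far_step; lia. }
  rewrite sumL_plus, sumL_scal in Hsum.
  rewrite (sumL_involution (2 * N - 1) (fun y => 2 * N - 2 - y)%nat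
            (fun q => / dist2 0 (q + 2))) in Hsum by (intros; lia).
  pose proof (sum_inv_dist2_le (2 * N - 1) ltac:(lia)) as H4.
  assert (0 < 2 / INR (2 * N - 1)) by (apply Rdiv_lt_0_compat; [lra|apply lt_0_INR; lia]).
  lra.
Qed.

(** * How the events move a discrepancy *)

Lemma flip_flip_comm (l : list bool) (i k : nat) : (i < length l)%nat -> (k < length l)%nat ->
  i <> k -> flip (flip l i) k = flip (flip l k) i.
Proof.
  intros Hi Hk Hne. apply bool_list_ext; [now rewrite !flip_length|].
  intros y _. rewrite !nth_flip by (rewrite ?flip_length; easy).
  destruct (Nat.eqb_spec y k), (Nat.eqb_spec y i), (Nat.eqb_spec k i), (Nat.eqb_spec i k);
    subst; try easy.
Qed.

Lemma flip_flip (l : list bool) (i : nat) : (i < length l)%nat -> flip (flip l i) i = l.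
Proof.
  intros Hi. apply bool_list_ext; [now rewrite !flip_length|].
  intros y _. rewrite !nth_flip by (rewrite ?flip_length; easy).
  rewrite Nat.eqb_refl, negb_involutive. destruct (Nat.eqb_spec y i); now subst.
Qed.

Lemma swap_flip (N i x : nat) (eta : list bool) : length eta = (2 * N + 1)%nat ->
  (i < 2 * N)%nat -> (x <= 2 * N)%nat ->
  swap (flip eta x) i (i + 1) = flip (swap eta i (i + 1)) (tau i x).
Proof.
  intros He Hi Hx. pose proof (tau_le N i x Hi Hx) as Ht.
  apply bool_list_ext; [now rewrite swap_length, !flip_length, swap_length|].
  intros y _. unfold swap. replace (i + 1)%nat with (S i) by lia.
  rewrite !nth_flip by (rewrite ?upd_length; lia).
  rewrite !nth_upd by (rewrite ?upd_length, ?flip_length; lia).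
  rewrite !nth_flip by lia. unfold tau in *.
  destruct (Nat.eqb_spec x i), (Nat.eqb_spec x (S i)); subst;
  repeat match goal with |- context [(?x =? ?y)%nat] => destruct (Nat.eqb_spec x y) end;
    subst; try lia; try easy.
Qed.

Lemma env_swap (N i y : nat) (eta : list bool) : length eta = (2 * N + 1)%nat ->
  (i < 2 * N)%nat -> env (swap eta i (i + 1)) y = env eta (tau i y).
Proof.
  intros He Hi. unfold env, swap, tau.
  rewrite !nth_upd by (rewrite ?upd_length; lia).
  replace (i + 1)%nat with (S i) by lia.
  repeat match goal with |- context [(?x =? ?y)%nat] => destruct (Nat.eqb_spec x y) end;
    subst; try lia; try easy.
Qed.

Lemma parab_end (N : nat) : (2 <= N)%nat -> parab N (2 * N - 1) <= parab N (2 * N).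
Proof.
  intros HN. unfold parab. rewrite minus_INR, mult_INR by lia. simpl (INR 2). simpl (INR 1).
  assert (2 <= INR N) by (apply (le_INR 2); lia).
  unfold Rdiv. rewrite !Rpow_mult_distr.
  apply Rmult_le_compat_r; [apply pow2_ge_0|]. nra.
Qed.

(** A surviving discrepancy stays put while both copies receive the same particle or none, or it
    moves from 2N to 2N - 1 because the copies fill different sites. *)
Lemma inject_flip (N x : nat) (B delta : R) (eta : list bool) : (2 <= N)%nat ->
  length eta = (2 * N + 1)%nat -> (x <= 2 * N)%nat -> 0 <= B -> 0 <= delta ->
  (inject N (flip eta x) = inject N eta /\ dies_right N x (env eta) = true) \/
  (dies_right N x (env eta) = false /\ exists x', (x' <= 2 * N)%nat /\
    inject N (flip eta x) = flip (inject N eta) x' /\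
    lyap N B delta x' (env (inject N eta)) <= lyap N B delta x (env eta) + delta * end_cost N x).
Proof.
  intros HN He Hx HB Hd.
  assert (Hadd : forall s, (x < 2 * N)%nat ->
    (s = 2 * N \/ (s = 2 * N - 1 /\ x < 2 * N - 1))%nat -> nth s eta false = false ->
    lyap N B delta x (env (flip eta s)) <= lyap N B delta x (env eta) + delta * end_cost N x).
  { intros s Hx1 Hs Hf. unfold lyap.
    assert (total_pot N x (env eta) - end_cost N x <= total_pot N x (env (flip eta s))).
    { apply total_pot_add_right with (s := s); auto; unfold env.
      - rewrite nth_flip, Nat.eqb_refl, Hf by lia. easy.
      - intros y _ Hy. rewrite nth_flip by lia. destruct (Nat.eqb_spec y s); easy. }
    nra. }
  assert (Hmove : forall xi, x = (2 * N)%nat -> nth (2 * N - 1) eta false = false ->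
    nth (2 * N) xi false = true ->
    (forall y, (y < 2 * N - 1)%nat -> nth y xi false = nth y eta false) ->
    lyap N B delta (2 * N - 1) (env xi) <= lyap N B delta x (env eta) + delta * end_cost N x).
  { intros xi -> H1 H2 H3. unfold lyap.
    pose proof (total_pot_move_right N (env eta) (env xi) HN H1 H2 H3).
    pose proof (parab_end N HN).
    unfold end_cost, is_end. rewrite Nat.eqb_refl, orb_true_r. nra. }
  destruct (Nat.lt_ge_cases x (2 * N - 1)) as [Hx1|Hx1].
  - right. split.
    { unfold dies_right. destruct (Nat.eqb_spec x (2 * N)), (Nat.eqb_spec x (2 * N - 1)); easy || lia. }
    exists x. split; [easy|]. unfold inject.
    rewrite !nth_flip by lia.
    destruct (Nat.eqb_spec (2 * N) x); [lia|]. destruct (Nat.eqb_spec (2 * N - 1) x); [lia|].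
    destruct (nth (2 * N) eta false) eqn:E1; [destruct (nth (2 * N - 1) eta false) eqn:E2|].
    + split; [easy|]. pose proof (end_cost_nonneg N x). nra.
    + split; [apply flip_flip_comm; lia|]. apply Hadd; auto; lia.
    + split; [apply flip_flip_comm; lia|]. apply Hadd; auto; lia.
  - assert (Hcase : x = (2 * N - 1)%nat \/ x = (2 * N)%nat) by lia.
    unfold dies_right, inject, env. destruct Hcase as [Ex|Ex].
    + rewrite !nth_flip by lia.
      destruct (Nat.eqb_spec (2 * N) x); [lia|].
      destruct (Nat.eqb_spec (2 * N - 1) x) as [_|]; [|lia].
      destruct (Nat.eqb_spec x (2 * N)); [lia|].
      destruct (Nat.eqb_spec x (2 * N - 1)) as [_|]; [|lia]. cbn [andb orb].
      destruct (nth (2 * N) eta false) eqn:E1.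
      * left. split; [|easy]. rewrite <- Ex.
        destruct (nth x eta false); simpl; [apply flip_flip; lia|easy].
      * right. split; [easy|]. exists x. split; [easy|].
        split; [apply flip_flip_comm; lia|]. apply Hadd; auto; lia.
    + subst x. rewrite !nth_flip, !Nat.eqb_refl by lia.
      destruct (Nat.eqb_spec (2 * N - 1) (2 * N)); [lia|].
      destruct (Nat.eqb_spec (2 * N) (2 * N - 1)); [lia|]. cbn [andb]. rewrite orb_false_r.
      destruct (nth (2 * N - 1) eta false) eqn:E2.
      * left. split; [|easy].
        destruct (nth (2 * N) eta false); cbn [negb]; [apply flip_flip; lia|easy].
      * right. split; [easy|]. exists (2 * N - 1)%nat. split; [lia|].
        destruct (nth (2 * N) eta false) eqn:E1; cbn [negb].
        -- split; [rewrite flip_flip by lia; symmetry; apply flip_flip; lia|].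
           apply Hmove; auto.
           ++ rewrite nth_flip by lia. destruct (Nat.eqb_spec (2 * N) (2 * N - 1)); [lia|easy].
           ++ intros y Hy. rewrite nth_flip by lia.
              destruct (Nat.eqb_spec y (2 * N - 1)); [lia|easy].
        -- split; [easy|]. apply Hmove; auto.
           ++ rewrite nth_flip, Nat.eqb_refl by lia. now rewrite E1.
           ++ intros y Hy. rewrite nth_flip by lia. destruct (Nat.eqb_spec y (2 * N)); [lia|easy].
Qed.

(** * Reflection and path coupling *)

(** Reflection combined with particle-hole exchange: it turns removal into injection, so the left
    end follows from the right. *)
Definition mirror (eta : list bool) : list bool := rev (map negb eta).

Lemma mirror_length (eta : list bool) : length (mirror eta) = length eta.
Proof. unfold mirror. now rewrite length_rev, length_map. Qed.

Lemma nth_mirror (eta : list bool) (y : nat) : (y < length eta)%nat ->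
  nth y (mirror eta) false = negb (nth (length eta - 1 - y) eta false).
Proof.
  intros Hy. unfold mirror. rewrite rev_nth, length_map by (now rewrite length_map).
  change false with (negb true) at 1. rewrite map_nth. f_equal.
  replace (length eta - S y)%nat with (length eta - 1 - y)%nat by lia.
  apply nth_indep. lia.
Qed.

Lemma mirror_involutive (eta : list bool) : mirror (mirror eta) = eta.
Proof.
  apply bool_list_ext; [now rewrite !mirror_length|]. intros y Hy. rewrite !mirror_length in Hy.
  rewrite !nth_mirror by (rewrite ?mirror_length; lia). rewrite mirror_length, negb_involutive.
  f_equal. lia.
Qed.

Lemma mirror_flip (N x : nat) (eta : list bool) : length eta = (2 * N + 1)%nat ->
  (x <= 2 * N)%nat -> mirror (flip eta x) = flip (mirror eta) (2 * N - x).
Proof.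
  intros He Hx. apply bool_list_ext; [now rewrite flip_length, !mirror_length, flip_length|].
  intros y Hy. rewrite mirror_length, flip_length in Hy.
  rewrite nth_flip by (rewrite mirror_length; lia).
  rewrite !nth_mirror by (rewrite ?flip_length; lia).
  rewrite flip_length, nth_flip, He by lia.
  destruct (Nat.eqb_spec (2 * N + 1 - 1 - y) x), (Nat.eqb_spec y (2 * N - x)); try lia; [|easy].
  f_equal. f_equal. f_equal. lia.
Qed.

Lemma remove_first_mirror (N : nat) (eta : list bool) : (1 <= N)%nat ->
  length eta = (2 * N + 1)%nat -> remove_first eta = mirror (inject N (mirror eta)).
Proof.
  intros HN He. unfold inject, remove_first.
  rewrite !nth_mirror by lia. rewrite He.
  replace (2 * N + 1 - 1 - 2 * N)%nat with 0%nat by lia.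
  replace (2 * N + 1 - 1 - (2 * N - 1))%nat with 1%nat by lia.
  assert (Hf : forall x, (x <= 2 * N)%nat ->
    mirror (flip (mirror eta) x) = flip eta (2 * N - x)).
  { intros x Hx. rewrite (mirror_flip N) by (rewrite ?mirror_length; easy).
    now rewrite mirror_involutive. }
  destruct (nth 0 eta false); cbn [negb].
  - rewrite Hf, Nat.sub_diag by lia. easy.
  - destruct (nth 1 eta false); cbn [negb].
    + rewrite Hf by lia. f_equal. lia.
    + now rewrite mirror_involutive.
Qed.

Lemma env_mirror (N y : nat) (eta : list bool) : length eta = (2 * N + 1)%nat ->
  (y <= 2 * N)%nat -> env (mirror eta) y = reflect_env N (env eta) y.
Proof.
  intros He Hy. unfold env, reflect_env. rewrite nth_mirror, He by lia. do 2 f_equal. lia.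
Qed.

Lemma lyap_reflect (N x : nat) (B delta : R) (e : nat -> bool) : (1 <= N)%nat ->
  (x <= 2 * N)%nat -> lyap N B delta x (reflect_env N e) = lyap N B delta (2 * N - x) e.
Proof.
  intros HN Hx. unfold lyap. f_equal; [f_equal; f_equal|f_equal].
  - unfold parab. rewrite minus_INR, mult_INR by lia. simpl (INR 2).
    assert (1 <= INR N) by (apply (le_INR 1); lia). field. lra.
  - unfold total_pot.
    rewrite <- (sumL_involution (2 * N + 1) (fun y => 2 * N - y)%nat) by (intros; lia).
    apply sumL_ext. intros y Hy. apply in_seq in Hy. unfold env_pot, reflect_env.
    replace (2 * N - (2 * N - y))%nat with y by lia.
    replace (2 * N - (2 * N - x))%nat with x by lia.
    destruct (Nat.eqb_spec (2 * N - y) x), (Nat.eqb_spec y (2 * N - x)); try lia; [easy|].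
    now destruct (e y).
Qed.

Lemma lyap_ext (N x : nat) (B delta : R) (e e' : nat -> bool) :
  (forall y, (y <= 2 * N)%nat -> e y = e' y) -> lyap N B delta x e = lyap N B delta x e'.
Proof.
  intros H. unfold lyap. now rewrite (total_pot_ext N x e e') by (intros; now apply H).
Qed.

Lemma dies_right_ext (N x : nat) (e e' : nat -> bool) :
  (forall y, (y <= 2 * N)%nat -> e y = e' y) -> dies_right N x e = dies_right N x e'.
Proof. intros H. unfold dies_right. now rewrite !H by lia. Qed.

Lemma remove_first_flip (N x : nat) (B delta : R) (eta : list bool) : (2 <= N)%nat ->
  length eta = (2 * N + 1)%nat -> (x <= 2 * N)%nat -> 0 <= B -> 0 <= delta ->
  (remove_first (flip eta x) = remove_first eta /\ dies_left N x (env eta) = true) \/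
  (dies_left N x (env eta) = false /\ exists x', (x' <= 2 * N)%nat /\
    remove_first (flip eta x) = flip (remove_first eta) x' /\
    lyap N B delta x' (env (remove_first eta))
      <= lyap N B delta x (env eta) + delta * end_cost N x).
Proof.
  intros HN He Hx HB Hd.
  assert (Hm : length (mirror eta) = (2 * N + 1)%nat) by (now rewrite mirror_length).
  rewrite !(remove_first_mirror N) by (rewrite ?flip_length; auto; lia).
  rewrite (mirror_flip N) by easy.
  assert (Hdies : dies_left N x (env eta) = dies_right N (2 * N - x) (env (mirror eta))).
  { apply dies_right_ext. intros y Hy. symmetry. now apply env_mirror. }
  rewrite Hdies.
  destruct (inject_flip N (2 * N - x) B delta (mirror eta) HN Hm ltac:(lia) HB Hd)
    as [[E H]|[H (x' & Hx' & E & HV)]].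
  - left. now rewrite E.
  - right. split; [easy|]. exists (2 * N - x')%nat. split; [lia|]. split.
    + rewrite E. apply mirror_flip; [now rewrite inject_length|easy].
    + rewrite (lyap_ext N (2 * N - x') B delta _ (reflect_env N (env (inject N (mirror eta)))))
        by (intros; apply env_mirror; [now rewrite inject_length|easy]).
      rewrite lyap_reflect by lia.
      replace (2 * N - (2 * N - x'))%nat with x' by lia.
      eapply Rle_trans; [exact HV|].
      rewrite (lyap_ext N (2 * N - x) B delta (env (mirror eta)) (reflect_env N (env eta)))
        by (intros; now apply env_mirror).
      rewrite lyap_reflect by lia.
      replace (2 * N - (2 * N - x))%nat with x by lia.
      apply Rplus_le_compat_l, Rmult_le_compat_l; [easy|]. right. unfold end_cost, is_end.
      destruct (Nat.eqb_spec (2 * N - x) 0), (Nat.eqb_spec (2 * N - x) (2 * N)),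
        (Nat.eqb_spec x 0), (Nat.eqb_spec x (2 * N)); easy || lia.
Qed.

(** * One-step contraction and interpolation *)

Lemma lyap_stirring (N x : nat) (B delta : R) (eta : list bool) : (2 <= N)%nat ->
  length eta = (2 * N + 1)%nat -> (x <= 2 * N)%nat -> 0 <= B -> 0 <= delta ->
  / 2 * sumL (seq 0 (2 * N)) (fun i =>
    lyap N B delta (tau i x) (env (swap eta i (i + 1))) - lyap N B delta x (env eta)) <=
  B * (if is_end N x then - / (2 * INR N) else / INR N ^ 2)
  - delta * (/ (16 * INR N) - 1000001 * ((if dies_right N x (env eta) then 1 else 0)
                                          + (if dies_left N x (env eta) then 1 else 0))).
Proof.
  intros HN He Hx HB Hd.
  rewrite (sumL_ext _ _ (fun i => B * (parab N (tau i x) - parab N x)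
    + - delta * (total_pot N (tau i x) (fun y => env eta (tau i y)) - total_pot N x (env eta)))).
  - rewrite sumL_plus, !sumL_scal, Rmult_plus_distr_l, <- !Rmult_assoc,
      !(Rmult_comm (/ 2)), !Rmult_assoc.
    rewrite total_pot_stir by lia.
    pose proof (parab_tau N x HN Hx) as HP. fold (is_end N x) in HP.
    pose proof (env_stir_lower N x (env eta) HN Hx) as HS.
    apply (Rmult_le_compat_l B) in HP; [|easy].
    apply (Rmult_le_compat_l delta) in HS; [|easy]. lra.
  - intros i Hi. apply in_seq in Hi. unfold lyap.
    rewrite (total_pot_ext N (tau i x) (env (swap eta i (i + 1))) (fun y => env eta (tau i y))).
    + ring.
    + intros y _ _. apply (env_swap N); [easy|lia].
Qed.

Lemma lyap_bounds (N x : nat) (B delta : R) (e : nat -> bool) : (2 <= N)%nat ->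
  (x <= 2 * N)%nat -> 0 <= B <= 1 -> 0 <= delta -> 2000190 * delta * INR (2 * N + 1) <= / 2 ->
  / 2 <= lyap N B delta x e <= 2.
Proof.
  intros HN Hx HB Hd Hdel. unfold lyap.
  pose proof (total_pot_nonneg N x e HN Hx). pose proof (total_pot_upper N x e HN Hx).
  assert (0 <= parab N x <= 1).
  { split; [apply pow2_ge_0|]. unfold parab.
    assert (2 <= INR N) by (apply (le_INR 2); lia).
    apply le_INR in Hx. rewrite mult_INR in Hx. simpl (INR 2) in Hx. pose proof (pos_INR x).
    rewrite <- (pow1 2). rewrite <- (pow2_abs (_ / _)). apply pow_incr.
    split; [apply Rabs_pos|]. apply Rabs_le.
    assert (Hq : (INR x - INR N) / INR N = INR x / INR N - 1) by (field; lra).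
    rewrite Hq.
    assert (0 <= INR x / INR N <= 2).
    { split; [apply Rmult_le_pos; [lra|left; apply Rinv_0_lt_compat; lra]|].
      apply Rmult_le_reg_r with (INR N); [lra|]. unfold Rdiv.
      rewrite Rmult_assoc, Rinv_l by lra. lra. }
    lra. }
  split; nra.
Qed.

Lemma lyap_bounds_scaled (N x : nat) (j eps : R) (e : nat -> bool) : (2 <= N)%nat ->
  (x <= 2 * N)%nat -> 0 < j -> 0 < eps -> eps * j <= / 10000000 ->
  / 2 <= lyap N (eps * brate N j * INR N / 32) (eps * brate N j) x e <= 2.
Proof.
  intros HN Hx Hj Heps Hepsj.
  assert (HN1 : 2 <= INR N) by (apply (le_INR 2); lia).
  assert (Hej : 0 < eps * j) by (apply Rmult_lt_0_compat; lra).
  assert (Hdel : eps * brate N j = eps * j / (2 * INR N)) by (unfold brate; field; lra).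
  assert (Hi : 0 < / (2 * INR N) <= 1).
  { split; [apply Rinv_0_lt_compat; lra|]. rewrite <- Rinv_1. apply Rinv_le_contravar; lra. }
  apply lyap_bounds; auto.
  - replace (eps * brate N j * INR N / 32) with (eps * j / 64) by (rewrite Hdel; field; lra). lra.
  - rewrite Hdel. apply Rmult_le_pos; lra.
  - rewrite Hdel, plus_INR, mult_INR. replace (INR 2) with 2 by (simpl; lra). simpl (INR 1).
    replace (2000190 * (eps * j / (2 * INR N)) * (2 * INR N + 1))
      with (2000190 * (eps * j * (1 + / (2 * INR N)))) by (field; lra).
    assert (eps * j * (1 + / (2 * INR N)) <= / 10000000 * 2)
      by (apply Rmult_le_compat; lra).
    lra.
Qed.

Lemma jump_flip_contracts (N x : nat) (j eps D : R) (g : list bool -> R) (eta : list bool) :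
  (2 <= N)%nat -> 0 < j -> 0 < eps <= / 10000000 -> eps * j <= / 10000000 ->
  640000000 * j <= INR N -> 0 <= D ->
  length eta = (2 * N + 1)%nat -> (x <= 2 * N)%nat ->
  let V := lyap N (eps * brate N j * INR N / 32) (eps * brate N j) in
  (forall xi z, length xi = (2 * N + 1)%nat -> (z <= 2 * N)%nat ->
    Rabs (g (flip xi z) - g xi) <= D * V z (env xi)) ->
  Rabs (jump N j g (flip eta x) - jump N j g eta) <=
  D * (1 - eps * j / 128 / INR N ^ 2 / total_rate N j) * V x (env eta).
Proof.
  intros HN Hj Heps Hepsj HNj HD He Hx V Hg.
  assert (HN1 : 2 <= INR N) by (apply (le_INR 2); lia).
  pose proof (brate_pos N j ltac:(lia) Hj) as Hr. pose proof (total_rate_pos N j ltac:(lia) Hj) as HL.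
  set (delta := eps * brate N j) in *. set (B := delta * INR N / 32) in *.
  assert (Hdel : delta = eps * j / (2 * INR N)) by (unfold delta, brate; field; lra).
  assert (Hd0 : 0 < delta) by (unfold delta; apply Rmult_lt_0_compat; lra).
  assert (HBe : B = eps * j / 64) by (unfold B; rewrite Hdel; field; lra).
  assert (Hej : 0 < eps * j) by (apply Rmult_lt_0_compat; lra).
  assert (HB : 0 <= B <= 1) by lra.
  assert (Hbd : forall z e, (z <= 2 * N)%nat -> / 2 <= V z e <= 2).
  { intros z e Hz. apply lyap_bounds_scaled; auto; lra. }
  set (JR := if dies_right N x (env eta) then 1 else 0).
  set (JL := if dies_left N x (env eta) then 1 else 0).
  set (c := delta * end_cost N x).
  assert (Hc : 0 <= c) by (apply Rmult_le_pos; [lra|apply end_cost_nonneg]).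
  pose proof (Hbd x (env eta) Hx) as HVx.
  set (v := V x (env eta)) in *.
  assert (Hinj : Rabs (g (inject N (flip eta x)) - g (inject N eta)) <= D * (v + c - JR * v)).
  { destruct (inject_flip N x B delta eta HN He Hx ltac:(lra) ltac:(lra))
      as [[E H]|[H (x' & Hx' & E & HV)]]; unfold JR; rewrite H, E.
    - rewrite Rminus_diag, Rabs_R0. apply Rmult_le_pos; lra.
    - eapply Rle_trans; [apply Hg; [now rewrite inject_length|easy]|].
      apply Rmult_le_compat_l; [easy|]. unfold V, v, c, V in *. lra. }
  assert (Hrem : Rabs (g (remove_first (flip eta x)) - g (remove_first eta))
                 <= D * (v + c - JL * v)).
  { destruct (remove_first_flip N x B delta eta HN He Hx ltac:(lra) ltac:(lra))
      as [[E H]|[H (x' & Hx' & E & HV)]]; unfold JL; rewrite H, E.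
    - rewrite Rminus_diag, Rabs_R0. apply Rmult_le_pos; lra.
    - eapply Rle_trans; [apply Hg; [now rewrite remove_first_length|easy]|].
      apply Rmult_le_compat_l; [easy|]. unfold V, v, c, V in *. lra. }
  assert (Hsw : Rabs (sumL (seq 0 (2 * N))
      (fun i => g (swap (flip eta x) i (i + 1)) - g (swap eta i (i + 1)))) <=
    D * sumL (seq 0 (2 * N)) (fun i => V (tau i x) (env (swap eta i (i + 1))))).
  { eapply Rle_trans; [apply sumL_abs|]. rewrite <- sumL_scal. apply sumL_le.
    intros i Hi. apply in_seq in Hi. rewrite (swap_flip N) by (auto; lia).
    apply Hg; [now rewrite swap_length|apply tau_le; lia]. }
  pose proof (lyap_stirring N x B delta eta HN He Hx ltac:(lra) ltac:(lra)) as Hst.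
  fold V v JR JL in Hst. rewrite sumL_minus, sumL_const, length_seq, mult_INR in Hst.
  simpl (INR 2) in Hst.
  set (S := sumL (seq 0 (2 * N)) (fun i => V (tau i x) (env (swap eta i (i + 1))))) in *.
  (* Inside, the potentials gain eps j/(32 N^2) and the parabola costs half of it, which fixes [B].
     At an end the parabola gains delta/64, enough for both boundary events because 5000000 j/N is
     at most 1/64. *)
  assert (Hdrift : B * (if is_end N x then - / (2 * INR N) else / INR N ^ 2)
      - delta * / (16 * INR N) + 2 * brate N j * c <= - (eps * j / 64 / INR N ^ 2)).
  { assert (HiN : 0 < / INR N) by (apply Rinv_0_lt_compat; lra).
    assert (HiN' : INR N * / INR N = 1) by (apply Rinv_r; lra).
    unfold c, end_cost. destruct (is_end N x).
    - replace (2 * brate N j * (delta * 5000000)) with (delta * (5000000 * j * / INR N))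
        by (unfold brate; field; lra).
      replace (eps * j / 64 / INR N ^ 2) with (delta * (/ 32 * / INR N))
        by (rewrite Hdel; field; lra).
      replace (B * - / (2 * INR N)) with (delta * - / 64) by (unfold B; field; lra).
      replace (/ (16 * INR N)) with (/ 16 * / INR N) by (field; lra).
      assert (Hj5 : 5000000 * j * / INR N <= / 64).
      { apply Rmult_le_reg_r with (INR N); [lra|]. rewrite Rmult_assoc, Rinv_l by lra. lra. }
      nra.
    - rewrite Rmult_0_r, Rmult_0_r. rewrite HBe, Hdel. right. field. lra. }
  assert (HJR : 0 <= JR) by (unfold JR; destruct dies_right; lra).
  assert (HJL : 0 <= JL) by (unfold JL; destruct dies_left; lra).
  (* The corner loss is below the gain from death since [delta] is [eps] times the boundary rate,
     eps <= 10^-7 and v >= 1/2. *)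
  assert (Hdeath : 1000001 * delta <= brate N j * v) by (unfold delta; nra).
  assert (Hmain : / 2 * S + brate N j * (v + c - JR * v) + brate N j * (v + c - JL * v)
    <= (total_rate N j - eps * j / 128 / INR N ^ 2) * v).
  { unfold total_rate.
    (* The bound v <= 2 makes the additive drift proportional to v, at the price of the factor 2
       between 64 and 128. *)
    assert (H64 : eps * j / 128 / INR N ^ 2 * v <= eps * j / 64 / INR N ^ 2).
    { replace (eps * j / 64 / INR N ^ 2) with (eps * j / 128 / INR N ^ 2 * 2) by (field; lra).
      apply Rmult_le_compat_l; [|lra]. unfold Rdiv.
      apply Rmult_le_pos; [lra|]. left. apply Rinv_0_lt_compat. nra. }
    assert (H1 : 1000001 * delta * JR <= brate N j * v * JR) by (apply Rmult_le_compat_r; lra).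
    assert (H2 : 1000001 * delta * JL <= brate N j * v * JL) by (apply Rmult_le_compat_r; lra).
    lra. }
  unfold jump. rewrite <- Rmult_minus_distr_l, Rabs_mult, Rabs_pos_eq
    by (left; now apply Rinv_0_lt_compat).
  apply Rmult_le_reg_l with (total_rate N j); [easy|].
  rewrite <- Rmult_assoc, Rinv_r, Rmult_1_l by lra.
  replace (total_rate N j * (D * (1 - eps * j / 128 / INR N ^ 2 / total_rate N j) * v))
    with (D * ((total_rate N j - eps * j / 128 / INR N ^ 2) * v)) by (field; lra).
  apply (Rmult_le_compat_l D) in Hmain; [|easy].
  eapply Rle_trans; [|exact Hmain].
  match goal with |- Rabs (/ 2 * ?a1 + ?r * ?b1 + ?r * ?c1 - (/ 2 * ?a2 + ?r * ?b2 + ?r * ?c2)) <= _ =>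
    replace (/ 2 * a1 + r * b1 + r * c1 - (/ 2 * a2 + r * b2 + r * c2))
      with (/ 2 * (a1 - a2) + r * (b1 - b2) + r * (c1 - c2)) by ring end.
  rewrite <- sumL_minus.
  eapply Rle_trans; [apply Rabs_triang|].
  eapply Rle_trans; [apply Rplus_le_compat_r, Rabs_triang|].
  rewrite !Rabs_mult, (Rabs_pos_eq (/ 2)), (Rabs_pos_eq (brate N j)) by lra.
  apply (Rmult_le_compat_l (brate N j)) in Hinj; [|lra].
  apply (Rmult_le_compat_l (brate N j)) in Hrem; [|lra].
  lra.
Qed.

(** Interpolation by single flips from left to right; [p] is the prefix on which the two
    configurations already agree. *)
Lemma flips_chain (n : nat) (g : list bool -> R) (D : R) :
  (forall eta x, length eta = n -> (x < n)%nat -> Rabs (g (flip eta x) - g eta) <= D) ->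
  0 <= D ->
  forall l m p, length l = length m -> (length p + length l = n)%nat ->
  Rabs (g (p ++ l) - g (p ++ m)) <= INR (length l) * D.
Proof.
  intros Hg HD l. induction l as [|a l IH]; intros [|b m] p E Hn; try easy.
  - simpl. rewrite Rminus_diag, Rabs_R0. lra.
  - change (length (a :: l)) with (S (length l)) in *. rewrite S_INR.
    injection E as E.
    specialize (IH m (p ++ [b]) E). rewrite length_app, <- !app_assoc in IH.
    cbn [length app] in IH.
    assert (Hfirst : Rabs (g (p ++ a :: l) - g (p ++ b :: l)) <= D).
    { destruct (bool_dec a b) as [->|Hab]; [rewrite Rminus_diag, Rabs_R0; easy|].
      replace (p ++ a :: l) with (flip (p ++ b :: l) (length p)).
      - apply Hg; [rewrite length_app; simpl; lia|lia].
      - unfold flip. rewrite nth_middle, upd_app. now destruct a, b. }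
    replace (g (p ++ a :: l) - g (p ++ b :: m))
      with ((g (p ++ a :: l) - g (p ++ b :: l)) + (g (p ++ b :: l) - g (p ++ b :: m))) by ring.
    eapply Rle_trans; [apply Rabs_triang|].
    specialize (IH ltac:(lia)). lra.
Qed.

(** As V is between 1/2 and 2, the initial difference 2 across a flip is at most 4 V, and after k
    steps it is at most 8 th^k. A chain of 2N + 1 <= 3N flips gives 24 N. *)
Lemma contracts_large_size (N : nat) (j eps : R) :
  (2 <= N)%nat -> 0 < j -> 0 < eps <= / 10000000 -> eps * j <= / 10000000 ->
  640000000 * j <= INR N ->
  contracts N j (24 * INR N) (1 - eps * j / 128 / INR N ^ 2 / total_rate N j).
Proof.
  intros HN Hj Heps Hepsj HNj f Hf k eta xi He Hxi.
  assert (HN1 : 2 <= INR N) by (apply (le_INR 2); lia).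
  pose proof (brate_pos N j ltac:(lia) Hj) as Hr.
  assert (HL : 1 <= total_rate N j) by (unfold total_rate; lra).
  set (th := 1 - eps * j / 128 / INR N ^ 2 / total_rate N j).
  assert (Hej : 0 < eps * j) by (apply Rmult_lt_0_compat; lra).
  assert (Hth : 0 <= th).
  { unfold th. assert (eps * j / 128 / INR N ^ 2 / total_rate N j <= 1); [|lra].
    apply Rmult_le_reg_r with (total_rate N j); [lra|].
    unfold Rdiv. rewrite !Rmult_assoc, Rinv_l by lra.
    assert (/ INR N ^ 2 <= 1) by (rewrite <- Rinv_1; apply Rinv_le_contravar; nra).
    assert (0 < / INR N ^ 2) by (apply Rinv_0_lt_compat; nra). nra. }
  set (V := lyap N (eps * brate N j * INR N / 32) (eps * brate N j)).
  assert (Hbd : forall z e, (z <= 2 * N)%nat -> / 2 <= V z e <= 2).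
  { intros z e Hz. apply lyap_bounds_scaled; auto; lra. }
  assert (Hpow : forall m, 0 <= th ^ m) by (intros; now apply pow_le).
  assert (Hflip : forall m z x, length z = (2 * N + 1)%nat -> (x <= 2 * N)%nat ->
    Rabs (jpow N j m f (flip z x) - jpow N j m f z) <= 4 * th ^ m * V x (env z)).
  { induction m as [|m IH]; intros z x Hz Hx.
    - simpl. specialize (Hbd x (env z) Hx).
      assert (H1 := Hf (flip z x) ltac:(now rewrite flip_length)). specialize (Hf z Hz).
      apply Rabs_le_between in H1, Hf. apply Rabs_le. lra.
    - change (Rabs (jump N j (jpow N j m f) (flip z x) - jump N j (jpow N j m f) z)
              <= 4 * th ^ S m * V x (env z)).
      replace (4 * th ^ S m) with (4 * th ^ m * th) by (cbn [pow]; ring).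
      apply jump_flip_contracts; auto. specialize (Hpow m). lra. }
  apply Rle_trans with (INR (length eta) * (8 * th ^ k)).
  - apply (flips_chain (2 * N + 1) (jpow N j k f) (8 * th ^ k)) with (p := []);
      [|specialize (Hpow k); lra|now rewrite He|easy].
    intros z x Hz Hx. eapply Rle_trans; [apply Hflip; [easy|lia]|].
    specialize (Hbd x (env z) ltac:(lia)). specialize (Hpow k). nra.
  - rewrite He, plus_INR, mult_INR. simpl (INR 2). simpl (INR 1).
    specialize (Hpow k). nra.
Qed.

(** * Constants uniform in the size *)

Lemma exp_monotone (x y : R) : x <= y -> exp x <= exp y.
Proof. intros [H | ->]; [left; now apply exp_increasing|lra]. Qed.

Definition relaxes (c b : R) (N : nat) (j : R) : Prop :=
  forall mu pist : list bool -> R,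
    is_prob N mu -> is_prob N pist -> stationary N j pist ->
    forall t : R, 0 < t ->
    forall nu : list bool -> R, law_at N j mu t nu ->
      tvnorm N (fun eta => nu eta - pist eta) <= c * INR N * exp (- b * t / (INR N ^ 2)).

Lemma relaxes_weaken (c c' b b' : R) (N : nat) (j : R) : (1 <= N)%nat ->
  0 <= c <= c' -> b' <= b -> relaxes c b N j -> relaxes c' b' N j.
Proof.
  intros HN Hc Hb H mu pist Hmu Hpi Hst t Ht nu Hnu.
  eapply Rle_trans; [now apply (H mu pist Hmu Hpi Hst t Ht nu)|].
  assert (1 <= INR N) by (apply (le_INR 1); lia).
  assert (Hi : 0 < / INR N ^ 2) by (apply Rinv_0_lt_compat; nra).
  apply Rmult_le_compat; [nra|left; apply exp_pos|nra|].
  apply exp_monotone. unfold Rdiv. apply Rmult_le_compat_r; [lra|]. nra.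
Qed.

Lemma relaxes_each_size (N : nat) (j : R) : (1 <= N)%nat -> 0 < j ->
  exists c b, 0 <= c /\ 0 < b /\ relaxes c b N j.
Proof.
  intros HN Hj. destruct (contracts_each_size N j HN Hj) as (K & th & HK & Hth & HC).
  pose proof (total_rate_pos N j HN Hj) as HL.
  assert (1 <= INR N) by (apply (le_INR 1); lia).
  exists K, (total_rate N j * (1 - th)). split; [easy|]. split; [apply Rmult_lt_0_compat; lra|].
  intros mu pist Hmu Hpi Hst t Ht nu Hnu.
  eapply Rle_trans; [now apply (tvnorm_le_of_contracts N j K th t mu)|].
  apply Rmult_le_compat; [easy|left; apply exp_pos|nra|].
  apply exp_monotone.
  assert (Hi : 0 < / INR N ^ 2 <= 1).
  { split; [apply Rinv_0_lt_compat; nra|]. rewrite <- Rinv_1. apply Rinv_le_contravar; nra. }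
  assert (0 < total_rate N j * (1 - th) * t) by (repeat apply Rmult_lt_0_compat; lra).
  unfold Rdiv. nra.
Qed.

Lemma relaxes_bounded_sizes (N0 : nat) (j : R) : 0 < j ->
  exists c b, 0 <= c /\ 0 < b /\ forall N, (1 <= N < N0)%nat -> relaxes c b N j.
Proof.
  intros Hj. induction N0 as [|N0 (c & b & Hc & Hb & H)].
  - exists 0, 1. split; [lra|]. split; [lra|]. intros; lia.
  - destruct (Nat.eq_dec N0 0) as [->|Hne].
    { exists c, b. split; [easy|]. split; [easy|]. intros; lia. }
    destruct (relaxes_each_size N0 j ltac:(lia) Hj) as (c' & b' & Hc' & Hb' & H').
    exists (Rmax c c'), (Rmin b b').
    pose proof (Rmax_l c c'). pose proof (Rmax_r c c').
    pose proof (Rmin_l b b'). pose proof (Rmin_r b b').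
    split; [lra|]. split; [apply Rmin_pos; lra|]. intros N HN.
    destruct (Nat.eq_dec N N0) as [->|Hne'].
    + apply (relaxes_weaken c' _ b'); solve [lia|lra|easy].
    + apply (relaxes_weaken c _ b); solve [lia|lra|apply H; lia].
Qed.

Theorem theorem3p1 (j : R) (hj : 0 < j) :
  exists c b : R, 0 < b /\
    forall N : nat, (2 <= N)%nat ->
    forall (mu pist : list bool -> R),
      is_prob N mu -> is_prob N pist -> stationary N j pist ->
      forall t : R, 0 < t ->
      forall nu : list bool -> R, law_at N j mu t nu ->
        tvnorm N (fun eta => nu eta - pist eta)
          <= c * INR N * exp (- b * t / (INR N ^ 2)).
Proof.
  destruct (INR_unbounded (640000000 * j)) as [N0 HN0].
  destruct (relaxes_bounded_sizes N0 j hj) as (c & b & Hc & Hb & H).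
  (* Small absolutely, so that death outweighs the corner loss, and small against 1/j, so that V
     stays between 1/2 and 2. *)
  set (eps := / (10000000 * (1 + j))).
  assert (Hi : 0 < / (1 + j)) by (apply Rinv_0_lt_compat; lra).
  assert (He : eps = / 10000000 * / (1 + j)) by (unfold eps; apply Rinv_mult).
  assert (Hi1 : / (1 + j) * (1 + j) = 1) by (apply Rinv_l; lra).
  assert (Heps : 0 < eps <= / 10000000) by (rewrite He; nra).
  assert (Hepsj : eps * j <= / 10000000) by (rewrite He; nra).
  assert (Hej : 0 < eps * j) by (apply Rmult_lt_0_compat; lra).
  pose proof (Rmax_l 24 c). pose proof (Rmax_r 24 c).
  pose proof (Rmin_l (eps * j / 128) b). pose proof (Rmin_r (eps * j / 128) b).
  exists (Rmax 24 c), (Rmin (eps * j / 128) b).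
  split; [apply Rmin_pos; lra|]. intros N HN.
  change (relaxes (Rmax 24 c) (Rmin (eps * j / 128) b) N j).
  destruct (Nat.lt_ge_cases N N0) as [HlN|HlN].
  - apply (relaxes_weaken c _ b); [lia|lra|lra|]. apply H. lia.
  - apply (relaxes_weaken 24 _ (eps * j / 128)); [lia|lra|lra|].
    apply le_INR in HlN as HlR.
    intros mu pist Hmu Hpi Hst t Ht nu Hnu.
    pose proof (contracts_large_size N j eps HN hj Heps Hepsj ltac:(lra)) as HC.
    pose proof (total_rate_pos N j ltac:(lia) hj) as HL.
    assert (2 <= INR N) by (apply (le_INR 2); lia).
    eapply Rle_trans; [apply (tvnorm_le_of_contracts N j _ _ t mu pist nu ltac:(lia) hj Ht HC); auto|].
    (* The total rate cancels: [total_rate N j] times one minus the contraction ratio is eps j/(128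
       N^2). *)
    right. f_equal. f_equal. field. split; lra.
Qed.
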